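(* Let $p>2$ be a prime number, let $f(x)=x^4+ax^2+bx+c\in\mathbb{Z}[x]$ be irreducible, $\theta$ a root of $f(x)$ in an algebraic closure of $\mathbb{Q}$, and $K=\mathbb{Q}(\theta)$. Suppose that $f(x)$ has two different double roots modulo $p$; equivalently, $p\nmid a$, $p\mid b$, $p\nmid c$, $a^2\equiv 4c\pmod p$ and $-a/2$ is a square modulo $p$. Put $\Delta=v_p(\operatorname{disc}(f))$ and $r=\min\{v_p(b),v_p(a^2-4c)\}$. Let $s$ be an integer such that $f(x)\equiv(x-s)^2(x+s)^2\pmod p$, both $s$ and $-s$ are regular, and $$\lfloor\min\{v_p(f(-s))/2,\,v_p(f'(-s))\}\rfloor\le \lfloor\min\{v_p(f(s))/2,\,v_p(f'(s))\}\rfloor .$$ Then $$1,\quad \theta,\quad \frac{\theta^2+s^2+a}{p^{\nu_-}},\quad \frac{\theta^3+s\theta^2+(a+s^2)\theta+s^3+as+b}{p^{\nu_+}}$$ is a $p$-integral basis of $K$, where $\nu_-=\lfloor r/2\rfloor$ and $\nu_+=\lfloor(\Delta-r)/2\rfloor$.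
   Context: $v_p$ is the $p$-adic valuation, $v_p(0)=\infty$. A $p$-integral basis of $K$ is a family of elements of $K$ that is a $\mathbb{Z}_{(p)}$-basis of $\mathbb{Z}_K\otimes_{\mathbb{Z}}\mathbb{Z}_{(p)}$, where $\mathbb{Z}_K$ is the ring of integers of $K$ and $\mathbb{Z}_{(p)}$ the localization of $\mathbb{Z}$ at $p$. Regular integers. For $s\in\mathbb{Z}$ write $f(x)=\sum_{i=0}^4 A_i(x-s)^i$, $A_i=f^{(i)}(s)/i!\in\mathbb{Z}$, $u_i=v_p(A_i)$. Let $N^-_{x-s}(f)$ be the union of the sides of negative slope of the lower convex envelope of the points $(i,u_i)$, $0\le i\le4$, $u_i<\infty$. For an integer abscissa $i$ put $c_i=\overline{A_i/p^{u_i}}\in\mathbb{F}_p$ if $(i,u_i)$ lies on $N^-_{x-s}(f)$ and $c_i=0$ otherwise. A side of slope $-h/e$ ($h,e$ positive coprime), initial abscissa $i_0$ and horizontal length $de$ has residual polynomial $c_{i_0}+c_{i_0+e}y+\cdots+c_{i_0+de}y^d\in\mathbb{F}_p[y]$. The integer $s$ is regular if the residual polynomials of all sides of $N^-_{x-s}(f)$ are separable. *)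

(* Defs.v *)
From HB Require Import structures.
From mathcomp Require Import all_boot all_order all_algebra all_field.
From mathcomp Require Import boolp constructive_ereal.

Set Implicit Arguments.
Unset Strict Implicit.
Unset Printing Implicit Defensive.

Import Order.TTheory GRing.Theory Num.Theory.
Local Open Scope ring_scope.

(* The values live in \bar rat so that v_p(0) is +oo; note that logn p 0 is 0. *)
Definition vp (p : nat) (z : int) : \bar rat :=
  if z == 0 then +oo%E else ((logn p `|z|%N)%:R)%:E.

(* This is the discriminant for monic f only: there is no division by the
   leading coefficient. *)
Definition monic_disc (f : {poly int}) : int :=
  (-1) ^+ 'C((size f).-1, 2) * resultant f f^`().

Definition red_poly (p : nat) (f : {poly int}) : {poly 'F_p} :=
  map_poly intr f.

Definition two_double_roots_mod (p : nat) (f : {poly int}) : Prop :=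
  exists alpha beta : 'F_p,
    [/\ alpha != beta, mup alpha (red_poly p f) = 2%N
      & mup beta (red_poly p f) = 2%N].

Section NewtonPolygon.

Variables (p : nat) (f : {poly int}) (s : int).

(* A_i = f^(i)(s) / i!, as f^`N(i) is the i-th derivative divided by i!. *)
Definition taylor_coef (i : nat) : int := (f^`N(i)).[s].

Definition in_hull (x y : rat) : Prop :=
  exists t : 'I_(size f) -> rat,
    [/\ forall i, 0 <= t i,
        forall i : 'I_(size f), vp p (taylor_coef i) = +oo%E -> t i = 0,
        \sum_i t i = 1,
        x = \sum_i t i * (i : nat)%:R
      & y = \sum_i t i * fine (vp p (taylor_coef i))].

Definition on_envelope (x y : rat) : Prop :=
  in_hull x y /\ forall y', in_hull x y' -> y <= y'.

Definition on_segment (P Q : rat * rat) (x y : rat) : Prop :=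
  exists t : rat, [/\ 0 <= t <= 1, x = (1 - t) * P.1 + t * Q.1
                    & y = (1 - t) * P.2 + t * Q.2].

Definition envelope_segment (P Q : rat * rat) : Prop :=
  P.1 < Q.1 /\ forall x y, on_segment P Q x y -> on_envelope x y.

(* A side is a maximal segment of the envelope. As the envelope has exactly one
   point on each vertical line that it meets, one of its segments contains
   another as soon as this is so for their projections to the x-axis. *)
Definition is_side (P Q : rat * rat) : Prop :=
  envelope_segment P Q /\
  forall P' Q', envelope_segment P' Q' -> P'.1 <= P.1 -> Q.1 <= Q'.1 ->
    P' = P /\ Q' = Q.

Definition on_Nminus (x y : rat) : Prop :=
  exists P Q, [/\ is_side P Q, Q.2 < P.2 & on_segment P Q x y].

Definition res_coef (i : nat) : 'F_p :=
  if `[< exists2 y, vp p (taylor_coef i) = y%:E & on_Nminus i%:R y >]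
  then ((taylor_coef i %/ (p ^ logn p `|taylor_coef i|)%N%:Z)%Z)%:~R
  else 0.

Definition residual_poly (i0 d e : nat) : {poly 'F_p} :=
  \poly_(j < d.+1) res_coef (i0 + j * e)%N.

(* The sides of slope - h / e, of horizontal length d * e; the vertices of the
   envelope are points (i, u_i), so every side of negative slope is of this
   form. *)
Definition regular_at : Prop :=
  forall (i0 d e h : nat) (y0 : rat),
    (0 < h)%N -> (0 < e)%N -> coprime h e ->
    is_side (i0%:R, y0) ((i0 + d * e)%N%:R, y0 - (d * h)%N%:R) ->
    separable_poly (residual_poly i0 d e).

End NewtonPolygon.

Definition floor_half_min (p : nat) (f : {poly int}) (s : int) : int :=
  Num.floor (fine (Order.min (vp p f.[s] * (2%:R^-1)%:E)%E
                             (vp p (f^`()).[s]))).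

Section IntegralBasis.

Variables (p : nat) (L : fieldExtType rat) (K : {subfield L}).

Definition in_Zloc (q : rat) : Prop :=
  exists m n : int, ~~ (p%:Z %| n)%Z /\ q = m%:~R / n%:~R.

Definition in_ring_of_integers (x : L) : Prop :=
  x \in K /\ integralOver (intr : int -> L) x.

(* The tensor product of the ring of integers with Z_(p) is its localization at
   the integers prime to p, a subring of K. *)
Definition in_ring_of_integers_loc (x : L) : Prop :=
  exists (z : L) (n : int),
    [/\ in_ring_of_integers z, ~~ (p%:Z %| n)%Z & x = z / n%:~R].

Definition p_integral_basis (n : nat) (w : n.-tuple L) : Prop :=
  [/\ forall i, in_ring_of_integers_loc (tnth w i),
      forall x, in_ring_of_integers_loc x ->
        exists2 c : 'I_n -> rat,
          forall i, in_Zloc (c i) & x = \sum_i c i *: tnth w i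
    & forall c : 'I_n -> rat, (forall i, in_Zloc (c i)) ->
        \sum_i c i *: tnth w i = 0 -> forall i, c i = 0].

End IntegralBasis.

(* Main.v *)
Require Import Defs.
From HB Require Import structures.
From mathcomp Require Import all_boot all_order all_algebra all_field.
From mathcomp Require Import boolp constructive_ereal.
From mathcomp Require Import zify ring lra.

Set Implicit Arguments.
Unset Strict Implicit.
Unset Printing Implicit Defensive.

Import Order.TTheory GRing.Theory Num.Theory.
Local Open Scope ring_scope.

(** The idea is to follow the factorization of f over the p-adic integers with
    integers only. Since f has no cubic term, its two quadratic factors over Z_p
    have opposite centres: f = ((x - t)^2 - d1) ((x + t)^2 - d2), where t reduces
    to s and 4 t^2 is a root of the resolvent cubic of f. Hensel's lemma gives,
    for each N, an integer t at which the resolvent is divisible by p^N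
    ([resolvent_root]). The numbers d1 and d2 that reproduce the coefficients a
    and b exactly are then rational, 4 t d1 and - 4 t d2 are the integers
    [local_disc a b t] and [local_disc a b (- t)], and only the constant term of
    f is off, by a multiple of the resolvent ([near_factor]).

    Write M and m for the two integers floor (min (v(f) / 2, v(f'))) at s and at
    - s. The exact index of Z[theta] at the first factor is floor (v(d1) / 2), and
    M can only be too small. If it is, then the Newton polygon at s is the one side
    from (0, 2M) to (2, 0), and its residual polynomial is a constant times a
    square. So regularity says that M = floor (v(d1) / 2) and, by the symmetry
    t -> - t, that m = floor (v(d2) / 2) ([local_index]). The discriminant of f is
    d1 d2 up to a unit and a multiple of the resolvent, and min (v(b), v(a^2 - 4c))
    is min (v(d1), v(d2)), because b and a^2 - 4c are, up to units and terms of
    higher order, the difference and the sum of d1 and d2. So nu_- = m and nu_+ = M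
    ([nu_values]).

    The third and the fourth element are integral because they satisfy explicit
    monic equations ([integral_w2], [integral_w3]). For maximality let z = h(theta)
    be integral, so that P(h) = f g for a monic P in Z[x] and some g in Q[x].
    Choose t so close to its limit that p^N kills the denominator of g. At a root
    x = t + y of the approximate factor, where y^2 = d1, the number
    P(h(x)) = f(x) g(x) is then integral at p, hence so is h(x) = al + be y; its
    trace and norm give that al and p^M be are in Z_(p) ([coords_near_root]). The
    same holds at the other factor. Finally the four numbers al1, p^M be1, al2,
    p^m be2 depend on the coordinates of h in the given basis through a matrix
    that is invertible over Z_(p) ([Zloc_coords]), so that the coordinates lie in
    Z_(p). *)

(** * The localization of Z at p inside Q *)

Section Localization.
Variable p : nat.
Hypothesis p_pr : prime p.
Implicit Types (q : rat) (n : int).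

Lemma Euclid_dvdzM m n : (p%:Z %| m * n)%Z = (p%:Z %| m)%Z || (p%:Z %| n)%Z.
Proof. by rewrite !dvdzE abszM Euclid_dvdM. Qed.

Lemma Euclid_dvdzX n k : ~~ (p%:Z %| n)%Z -> ~~ (p%:Z %| n ^+ k)%Z.
Proof. by rewrite !dvdzE abszX; apply: contra; rewrite Euclid_dvdX // => /andP[]. Qed.

Lemma dvdz_nz n : ~~ (p%:Z %| n)%Z -> n != 0.
Proof. by apply: contra => /eqP->; apply: dvdz0. Qed.

Lemma Gauss_dvdzX k m n : ~~ (p%:Z %| m)%Z ->
  ((p%:Z ^+ k %| m * n)%Z = (p%:Z ^+ k %| n)%Z).
Proof.
move=> pm; rewrite Gauss_dvdzr //.
by rewrite coprimezE abszX coprimeXl // prime_coprime // -dvdzE.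
Qed.

Lemma Zloc_int n : in_Zloc p n%:~R.
Proof.
exists n, 1; rewrite divr1; split=> //.
by rewrite dvdz1 /=; case: (p) p_pr => [|[]].
Qed.

Lemma Zloc_nat k : in_Zloc p k%:R.
Proof. by have := Zloc_int k; rewrite -pmulrn. Qed.

Lemma ZlocD q1 q2 : in_Zloc p q1 -> in_Zloc p q2 -> in_Zloc p (q1 + q2).
Proof.
case=> [m1 [n1 [pn1 ->]]] [m2 [n2 [pn2 ->]]].
exists (m1 * n2 + m2 * n1), (n1 * n2); split.
  by rewrite Euclid_dvdzM negb_or pn1.
have ? : n1%:~R != 0 :> rat by rewrite intr_eq0 dvdz_nz.
have ? : n2%:~R != 0 :> rat by rewrite intr_eq0 dvdz_nz.
by rewrite rmorphD !rmorphM /=; field; apply/andP.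
Qed.

Lemma ZlocM q1 q2 : in_Zloc p q1 -> in_Zloc p q2 -> in_Zloc p (q1 * q2).
Proof.
case=> [m1 [n1 [pn1 ->]]] [m2 [n2 [pn2 ->]]].
exists (m1 * m2), (n1 * n2); split.
  by rewrite Euclid_dvdzM negb_or pn1.
by rewrite !rmorphM /= mulf_div.
Qed.

Lemma ZlocN q : in_Zloc p q -> in_Zloc p (- q).
Proof. by move=> h; rewrite -mulN1r; apply: ZlocM => //; apply: (Zloc_int (-1)). Qed.

Lemma ZlocB q1 q2 : in_Zloc p q1 -> in_Zloc p q2 -> in_Zloc p (q1 - q2).
Proof. by move=> h1 h2; apply: ZlocD => //; apply: ZlocN. Qed.

Lemma ZlocX q k : in_Zloc p q -> in_Zloc p (q ^+ k).
Proof.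
by move=> h; elim: k => [|k IH]; rewrite ?exprS; [apply: (Zloc_nat 1)|apply: ZlocM].
Qed.

Lemma Zloc_inv n : ~~ (p%:Z %| n)%Z -> in_Zloc p n%:~R^-1.
Proof. by move=> pn; exists 1, n; rewrite div1r. Qed.

(** The units of Z_(p) that occur below are given by an integer prime to p plus a
    multiple of p. *)
Lemma Zloc_1p_inv n q : ~~ (p%:Z %| n)%Z -> in_Zloc p q ->
  n%:~R + p%:R * q != 0 /\ in_Zloc p (n%:~R + p%:R * q)^-1.
Proof.
move=> pn [m [k [pk ->]]].
have k0 : k%:~R != 0 :> rat by rewrite intr_eq0 dvdz_nz.
have pd : ~~ (p%:Z %| n * k + p%:Z * m)%Z.
  rewrite rpredDr; first by rewrite Euclid_dvdzM negb_or pn.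
  exact: (dvdz_mulr m (dvdzz _)).
have E : n%:~R + p%:R * (m%:~R / k%:~R) = (n * k + p%:Z * m)%:~R / k%:~R :> rat.
  by rewrite rmorphD !rmorphM /= -pmulrn; field.
split; first by rewrite E mulf_neq0 ?invr_eq0 // intr_eq0 dvdz_nz.
by exists k, (n * k + p%:Z * m); rewrite E invf_div.
Qed.

(** If p divided the denominator of q, then p^2 would have to divide n. *)
Lemma Zloc_sqr q n : in_Zloc p (q ^+ 2 * n%:~R) -> ~~ (p%:Z ^+ 2 %| n)%Z ->
  in_Zloc p q.
Proof.
move=> [m [k [pk E]]] pn; exists (numq q), (denq q); split; last by rewrite divq_num_den.
apply/negP => pd; case/negP: pn.
have pnum : ~~ (p%:Z %| numq q)%Z.
  apply/negP => pnq.
  have := coprime_num_den q.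
  move: pnq pd; rewrite !dvdzE /= => h1 h2 /eqP h3.
  have : (p %| 1)%N by rewrite -h3 dvdn_gcd h1.
  by rewrite dvdn1; case: (p) p_pr => [|[]].
have k0 : k%:~R != 0 :> rat by rewrite intr_eq0 dvdz_nz.
have d0 : (denq q)%:~R != 0 :> rat by rewrite intr_eq0 denq_neq0.
have EE : numq q ^+ 2 * n * k = m * denq q ^+ 2.
  apply: (@intr_inj rat); rewrite !(rmorphM, rmorphXn) /=.
  have q_eq : (numq q)%:~R = q * (denq q)%:~R :> rat.
    by rewrite -{2}(divq_num_den q) divfK.
  rewrite q_eq exprMn.
  have -> : q ^+ 2 * (denq q)%:~R ^+ 2 * n%:~R * k%:~R =
            (q ^+ 2 * n%:~R) * (denq q)%:~R ^+ 2 * k%:~R by ring.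
  by rewrite E; field.
have : (p%:Z ^+ 2 %| (numq q ^+ 2 * k) * n)%Z.
  by rewrite mulrAC EE dvdz_mull // dvdz_exp2r.
by rewrite Gauss_dvdzX // Euclid_dvdzM negb_or pk Euclid_dvdzX.
Qed.

End Localization.

(** * Valuations of integers *)

Lemma floor_half (n : nat) : Num.floor (n%:R / 2 : rat) = (n %/ 2)%N%:Z.
Proof.
apply: floor_def; rewrite -[Posz _ + 1]/(Posz (_ + 1)) -!pmulrn.
rewrite ler_pdivlMr // ltr_pdivrMr // -!natrM ler_nat ltr_nat.
by have := divn_eq n 2; have := ltn_pmod n (isT : 0 < 2)%N; lia.
Qed.

Section Valuation.
Variable p : nat.
Hypothesis p_pr : prime p.

Lemma dvdz_logn (z : int) k : z != 0 ->
  (p%:Z ^+ k %| z)%Z = (k <= logn p `|z|%N)%N.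
Proof. by move=> z0; rewrite dvdzE abszX pfactor_dvdn // absz_gt0. Qed.

Lemma dvdz_dvdXn (z : int) k l : (k <= l)%N -> (p%:Z ^+ l %| z)%Z -> (p%:Z ^+ k %| z)%Z.
Proof. by move=> kl; apply: dvdz_trans; apply: dvdz_exp2l. Qed.

Lemma lognE_dvd (z : int) k : (p%:Z ^+ k %| z)%Z -> ~~ (p%:Z ^+ k.+1 %| z)%Z ->
  z != 0 /\ logn p `|z|%N = k.
Proof.
have [->|z0] := eqVneq z 0; first by rewrite !dvdz0.
by rewrite !dvdz_logn // -ltnNge ltnS => h1 h2; split=> //; apply/anti_leq; rewrite h2 h1.
Qed.

Lemma vp_fin (z : int) : z != 0 -> vp p z = ((logn p `|z|%N)%:R)%:E.
Proof. by rewrite /vp => /negPf->. Qed.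

(** The maximality of M is stated by divisibility, since v(f'(s)) may be infinite. *)
Lemma floor_half_minP (f : {poly int}) (s : int) : f.[s] != 0 ->
  exists M : nat, [/\ floor_half_min p f s = M,
    (p%:Z ^+ M.*2 %| f.[s])%Z, (p%:Z ^+ M %| f^`().[s])%Z
    & ~ ((p%:Z ^+ M.*2.+2 %| f.[s])%Z /\ (p%:Z ^+ M.+1 %| f^`().[s])%Z)].
Proof.
move=> fs0; rewrite /floor_half_min vp_fin //.
set n := logn p _.
have [f's0|f's0] := eqVneq (f^`().[s]) 0.
  exists (n %/ 2)%N; rewrite f's0 !dvdz0 /vp eqxx minEle leey /= floor_half.
  rewrite !dvdz_logn // -/n; have := divn_eq n 2; have := ltn_pmod n (isT : 0 < 2)%N.
  split=> //; [lia|case; lia].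
rewrite vp_fin //; set n1 := logn p `|f^`().[s]|%N.
rewrite -EFinM; exists (minn (n %/ 2) n1)%N.
rewrite !dvdz_logn // -/n -/n1.
have := divn_eq n 2; have := ltn_pmod n (isT : 0 < 2)%N => h1 h2.
split; try lia.
rewrite -EFin_min /= /Order.min; case: ltP.
  rewrite ltr_pdivrMr // -natrM ltr_nat floor_half => h; congr Posz; lia.
rewrite ler_pdivlMr // -natrM ler_nat => h.
by rewrite pmulrn intrKfloor; congr Posz; lia.
Qed.

Lemma vp_min_fin (y z : int) r :
  (p%:Z ^+ r %| y)%Z -> (p%:Z ^+ r %| z)%Z ->
  ~ ((p%:Z ^+ r.+1 %| y)%Z /\ (p%:Z ^+ r.+1 %| z)%Z) ->
  Order.min (vp p y) (vp p z) = (r%:R)%:E.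
Proof.
rewrite /vp; have [->|y0] := eqVneq y 0; have [->|z0] := eqVneq z 0.
- by rewrite !dvdz0 => _ _ [].
- rewrite !dvdz0 !dvdz_logn // minC minEle leey => _ h1 h2; congr (_%:R)%:E.
  by apply/anti_leq; rewrite h1 andbT leqNgt; apply/negP => h; apply: h2.
- rewrite !dvdz0 !dvdz_logn // minEle leey => h1 _ h2; congr (_%:R)%:E.
  by apply/anti_leq; rewrite h1 andbT leqNgt; apply/negP => h; apply: h2.
rewrite !dvdz_logn // => h1 h2 h3.
rewrite -EFin_min; congr EFin; rewrite /Order.min ltr_nat.
by case: ltnP => h; congr _%:R; lia.
Qed.

End Valuation.

(** * Elements integral at p *)

Section IntegralAt.
Variable p : nat.
Hypothesis p_pr : prime p.

(** This is integrality over Z_(p), stated over Z so that the closure properties of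
    integral elements apply. *)
Definition integral_at (E : fieldType) (y : E) : Prop :=
  exists2 n : int, ~~ (p%:Z %| n)%Z & integralOver (intr : int -> E) (n%:~R * y).

Variable E : fieldType.
Implicit Types y z : E.

Lemma integral_int (n : int) : integralOver (intr : int -> E) n%:~R.
Proof. exact: (integral_id (intr : {rmorphism int -> E})). Qed.

Lemma integral_at_integral y : integralOver (intr : int -> E) y -> integral_at y.
Proof.
move=> iy; exists 1; last by rewrite mul1r.
by rewrite dvdz1 /=; case: (p) p_pr => [|[]].
Qed.

Lemma integral_at_int (n : int) : integral_at (n%:~R : E).
Proof. by apply: integral_at_integral; apply: integral_int. Qed.

Lemma integral_atM y z : integral_at y -> integral_at z -> integral_at (y * z).
Proof.
case=> [n pn iy] [m pm iz]; exists (n * m); first by rewrite Euclid_dvdzM // negb_or pn.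
by rewrite rmorphM /= mulrACA; apply: integral_mul.
Qed.

Lemma integral_atD y z : integral_at y -> integral_at z -> integral_at (y + z).
Proof.
case=> [n pn iy] [m pm iz]; exists (n * m); first by rewrite Euclid_dvdzM // negb_or pn.
rewrite rmorphM /= mulrDr.
have -> : n%:~R * m%:~R * y + n%:~R * m%:~R * z =
          m%:~R * (n%:~R * y) + n%:~R * (m%:~R * z) :> E by ring.
by apply: integral_add; apply: integral_mul => //; apply: integral_int.
Qed.

Lemma integral_at_cancel y (n : int) : ~~ (p%:Z %| n)%Z ->
  integral_at (n%:~R * y) -> integral_at y.
Proof.
move=> pn [m pm iy]; exists (m * n); first by rewrite Euclid_dvdzM // negb_or pm.
by rewrite rmorphM /= -mulrA.
Qed.

Lemma integral_at_horner (P : {poly int}) y : integral_at y ->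
  integral_at (map_poly intr P).[y].
Proof.
move=> iy; elim/poly_ind: P => [|P c IH].
  by rewrite rmorph0 horner0; apply: (integral_at_int 0).
rewrite rmorphD rmorphM /= map_polyX map_polyC /= hornerMXaddC.
by apply: integral_atD (integral_at_int _); apply: integral_atM.
Qed.

(** Scaling P by powers of a denominator n of its value at y makes n y a root of a
    monic polynomial with integral coefficients: the scaled P minus a constant. *)
Lemma integral_at_root (P : {poly int}) y : P \is monic -> (1 < size P)%N ->
  integral_at (map_poly intr P).[y] -> integral_at y.
Proof.
move=> mP sP [n pn ie]; exists n => //.
have [d sPE] : exists d, size P = d.+2 by case: (size P) sP => [|[|d]] // _; exists d.
pose Q : {poly int} := \poly_(i < d.+2) (P`_i * n ^+ (d.+1 - i)).
have lP : P`_d.+1 = 1 by move/monicP: mP; rewrite /lead_coef sPE.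
have QP : (map_poly intr Q).[n%:~R * y] = n%:~R ^+ d.+1 * (map_poly intr P).[y].
  have szQ : (size (map_poly intr Q : {poly E}) <= d.+2)%N.
    by apply: leq_trans (size_poly _ _) _; apply: size_poly.
  have szP : (size (map_poly intr P : {poly E}) <= d.+2)%N.
    by apply: leq_trans (size_poly _ _) _; rewrite sPE.
  rewrite (horner_coef_wide _ szQ) (horner_coef_wide _ szP) mulr_sumr.
  apply: eq_bigr => i _; rewrite !coef_map /= coef_poly ltn_ord rmorphM rmorphXn /=.
  have le : (i <= d.+1)%N by rewrite -ltnS.
  have -> : n%:~R ^+ d.+1 = n%:~R ^+ (d.+1 - i) * n%:~R ^+ i :> E.
    by rewrite -exprD subnK.
  by rewrite exprMn; ring.
pose T : {poly E} := map_poly intr Q - (n%:~R ^+ d.+1 * (map_poly intr P).[y])%:P.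
have mQ : (map_poly intr Q : {poly E}) \is monic.
  apply: monic_map; apply/monicP.
  by rewrite lead_coef_poly // subnn expr0 mulr1 lP ?oner_eq0.
have szQ : size (map_poly intr Q : {poly E}) = d.+2.
  rewrite size_map_poly_id0.
    by rewrite size_poly_eq // subnn expr0 mulr1 lP oner_eq0.
  by rewrite lead_coef_poly // subnn expr0 mulr1 lP ?rmorph1 oner_eq0.
apply: (@integral_root_monic _ _ _ _ T).
- apply/monicP; rewrite lead_coefDl; first exact/monicP.
  by rewrite size_polyN szQ; apply: leq_ltn_trans (size_polyC_leq1 _) _.
- by rewrite /root /T !hornerE /= QP subrr.
apply/integral_poly => i; rewrite coefB coef_map coefC.
apply: integral_sub; first exact: integral_int.
case: ifP => _; last exact: integral0.
rewrite exprSr -mulrA; apply: integral_mul ie.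
by rewrite -rmorphXn /=; apply: integral_int.
Qed.

End IntegralAt.

Lemma integral_at_rat p (q : rat) : prime p ->
  integral_at p (ratr q : algC) -> in_Zloc p q.
Proof.
move=> p_pr [n pn [P mP rP]].
have rat_nq : n%:~R * ratr q = ratr (n%:~R * q) :> algC by rewrite rmorphM /= ratr_int.
have /Cint_rat_Aint : n%:~R * ratr q \in (Crat : {pred algC}).
  by rewrite rat_nq; apply: Crat_rat.
case/(_ _)/intrP.
  apply: root_monic_Aint rP (monic_map _ mP) _.
  by apply/polyOverP => i; rewrite coef_map /= intr_int.
move=> m; rewrite rat_nq -(ratr_int _ m) => /fmorph_inj E.
exists m, n; split=> //; by rewrite -E [_ * q]mulrC mulfK // intr_eq0 (dvdz_nz pn).
Qed.

(** * Discriminant of a depressed quartic *)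

Section SparseDet.
Variable R : comNzRingType.

(** This is [bump], written with functions that compute on numerals. *)
Definition skip (j k : nat) : nat := if Nat.leb j k then k.+1 else k.

(** Laplace expansion along the first row that omits the entries known to vanish,
    so that a determinant with many zeros unfolds to a short expression. *)
Fixpoint sparse_det (n : nat) (F : nat -> nat -> option R) : R :=
  if n is n'.+1 then
    foldr (fun j acc =>
      if F 0%N j is Some x then
        (-1) ^+ j * x * sparse_det n' (fun i k => F i.+1 (skip j k)) + acc
      else acc) 0 (iota 0 n)
  else 1.

Lemma skipE j k : skip j k = bump j k.
Proof.
rewrite /skip /bump; have -> : Nat.leb j k = (j <= k)%N by apply/idP/idP => ?; lia.
by case: leqP.
Qed.

Lemma sparse_detE n (F : nat -> nat -> option R) :
  sparse_det n F = \det (\matrix_(i < n, j < n) odflt 0 (F i j)).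
Proof.
elim: n F => [|n IH] F; first by rewrite det_mx00.
pose G (j : nat) := odflt 0 (F 0%N j) *
  ((-1) ^+ j * \det (\matrix_(i < n, k < n) odflt 0 (F i.+1 (bump j k)))).
have -> : \det (\matrix_(i < n.+1, j < n.+1) odflt 0 (F i j)) = \sum_(j < n.+1) G j.
  rewrite (expand_det_row _ ord0); apply: eq_bigr => j _.
  rewrite mxE /cofactor add0n /G; congr (_ * (_ * _)).
  congr (\det _).
  by apply/matrixP => i k; rewrite !mxE /= /bump leq0n add1n.
rewrite -(big_mkord xpredT G) /index_iota subn0 [sparse_det _ _]/sparse_det -/sparse_det.
elim: (iota 0 n.+1) => [|j l IHl]; first by rewrite big_nil.
rewrite big_cons -IHl /= /G; case: (F 0%N j) => [x|] /=; last by rewrite mul0r add0r.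
congr (_ + _); rewrite IH mulrCA mulrA; congr (_ * _); congr (\det _).
by apply/matrixP => i k; rewrite !mxE skipE.
Qed.

End SparseDet.

Lemma quartic_polyseq (R : nzRingType) (a b c : R) :
  'X^4 + a *: 'X^2 + b *: 'X + c%:P = Poly [:: c; b; a; 0; 1].
Proof.
apply/polyP => i; rewrite coef_Poly !coefE.
by case: i => [|[|[|[|[|i]]]]] //=; rewrite ?(mulr0, mulr1, addr0, add0r) ?nth_nil.
Qed.

Lemma size_quartic (R : nzRingType) (a b c : R) :
  size ('X^4 + a *: 'X^2 + b *: 'X + c%:P) = 5.
Proof. by rewrite quartic_polyseq (@PolyK _ 0) //= oner_eq0. Qed.

Lemma deriv_quartic (R : nzRingType) (a b c : R) :
  ('X^4 + a *: 'X^2 + b *: 'X + c%:P)^`() = Poly [:: b; a *+ 2; 0; 4].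
Proof.
apply/polyP => i; rewrite quartic_polyseq coef_deriv !coef_Poly.
by case: i => [|[|[|[|i]]]] //=; rewrite ?nth_nil ?mul0rn ?mulr1n.
Qed.

(** The resultant is a 7 x 7 Sylvester determinant with few nonzero entries, which
    is expanded by computation. *)
Lemma disc_quartic (a b c : int) :
  monic_disc ('X^4 + a *: 'X^2 + b *: 'X + c%:P) =
  16 * a ^+ 4 * c - 4 * a ^+ 3 * b ^+ 2 - 128 * a ^+ 2 * c ^+ 2
  + 144 * a * b ^+ 2 * c - 27 * b ^+ 4 + 256 * c ^+ 3.
Proof.
rewrite /monic_disc size_quartic; set f := _ + c%:P.
pose cf (k : nat) : option int :=
  match k with 0 => Some c | 1 => Some b | 2 => Some a | 4 => Some 1 | _ => None end.
pose cg (k : nat) : option int :=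
  match k with 0 => Some b | 1 => Some (2 * a) | 3 => Some 4 | _ => None end.
have fE k : f`_k = odflt 0 (cf k).
  by rewrite /f quartic_polyseq coef_Poly; case: k => [|[|[|[|[|k]]]]] //=; rewrite nth_nil.
have gE k : f^`()`_k = odflt 0 (cg k).
  rewrite /f deriv_quartic coef_Poly; case: k => [|[|[|[|k]]]] //=; rewrite ?nth_nil //.
  by rewrite mulr2n; ring.
have sg : size f^`() = 4 by rewrite /f deriv_quartic (@PolyK _ 0).
(* the entries of the Sylvester matrix *)
pose F (i j : nat) : option int :=
  if Nat.ltb i 3 then (if Nat.leb i j then cf (Nat.sub j i) else None)
  else (if Nat.leb (Nat.sub i 3) j then cg (Nat.sub j (Nat.sub i 3)) else None).
have -> : resultant f f^`() = sparse_det 7 F.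
  have -> : resultant f f^`() = \det (\matrix_(i < (size f^`()).-1 + (size f).-1,
      j < (size f^`()).-1 + (size f).-1) odflt 0 (F i j)).
    rewrite /resultant; congr (\det _); apply/matrixP => i j.
    rewrite Sylvester_mxE mxE /F; have i3 := ltn_ord i.
    have lebE m n : Nat.leb m n = (m <= n)%N by apply/idP/idP => ?; lia.
    have subE m n : Nat.sub m n = (m - n)%N by [].
    rewrite /Nat.ltb !lebE !subE.
    case: (splitP i) => k ->; rewrite ?fE ?gE.
      have := ltn_ord k; rewrite [X in (_ < X)%N -> _](congr1 predn sg) => k3.
      rewrite k3.
      by case: (k <= j)%N.
    have -> : (3 = (size f^`()).-1)%N by rewrite sg.
    by rewrite ltnNge leq_addr addKn /=; case: (k <= j)%N.
  by rewrite sparse_detE sg size_quartic.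
rewrite /F /cf /cg.
cbv [sparse_det foldr iota Nat.ltb Nat.leb Nat.sub skip].
rewrite (_ : (-1) ^+ 'C(5.-1, 2) = 1 :> int) //.
ring.
Qed.

(** * A Newton polygon with a single side *)

Lemma quadratic_double_root (F : fieldType) (u v w : F) :
  2 != 0 :> F -> w != 0 -> v ^+ 2 = 4 * u * w ->
  exists x, u + v * x + w * x ^+ 2 = 0 /\ v + 2 * w * x = 0.
Proof.
move=> two w0 sq; pose x := - v / (2 * w); exists x; split; last by rewrite /x; field; rewrite w0.
have -> : u + v * x + w * x ^+ 2 = (4 * u * w - v ^+ 2) / (4 * w).
  have : 4 = 2 * 2 :> F by ring.
  by rewrite /x => E; field; rewrite E mulf_neq0 ?w0.
by rewrite sq subrr mul0r.
Qed.

Lemma vp_pmul p k (m : int) : prime p -> ~~ (p%:Z %| m)%Z ->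
  vp p (p%:Z ^+ k * m) = (k%:R)%:E.
Proof.
move=> p_pr pm; have p0 := prime_gt0 p_pr; have m0 := dvdz_nz pm.
rewrite /vp mulf_eq0 expf_eq0 (negPf m0) orbF eqz_nat -[p == 0%N]negbK -lt0n p0 andbF.
congr (_%:R)%:E; rewrite abszM abszX lognM ?expn_gt0 ?p0 ?absz_gt0 //.
rewrite lognX /= logn_prime // eqxx muln1 logn_coprime ?addn0 //.
by rewrite prime_coprime.
Qed.

Lemma vp_unit p (m : int) : prime p -> ~~ (p%:Z %| m)%Z -> vp p m = (0%:R)%:E.
Proof. by move=> p_pr /(vp_pmul 0 p_pr); rewrite expr0 mul1r. Qed.

Lemma Fp_intr_eq0 p (m : int) : prime p -> ((m%:~R : 'F_p) == 0) = (p%:Z %| m)%Z.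
Proof.
move=> p_pr; rewrite dvdzE /=; case: m => k.
  by rewrite -pmulrn -(dvdn_pcharf (pchar_Fp p_pr)).
by rewrite NegzE mulrNz oppr_eq0 -pmulrn -(dvdn_pcharf (pchar_Fp p_pr)).
Qed.

Section OneSide.

Variables (p : nat) (f : {poly int}) (s : int) (M : nat) (a0 a1 : int).
Hypotheses (p_pr : prime p) (M0 : (0 < M)%N) (sf : size f = 5).
Let A := taylor_coef f s.
Hypotheses (A0 : A 0 = p%:Z ^+ M.*2 * a0) (A1 : A 1 = p%:Z ^+ M * a1).
Hypotheses (pa0 : ~~ (p%:Z %| a0)%Z) (pa1 : ~~ (p%:Z %| a1)%Z).
Hypotheses (pA2 : ~~ (p%:Z %| A 2)%Z) (pA3 : ~~ (p%:Z %| A 3)%Z)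
  (pA4 : ~~ (p%:Z %| A 4)%Z).

Let vA0 : vp p (taylor_coef f s 0) = (M.*2%:R)%:E.
Proof. by rewrite -/A A0 vp_pmul. Qed.
Let vA1 : vp p (taylor_coef f s 1) = (M%:R)%:E.
Proof. by rewrite -/A A1 vp_pmul. Qed.
Let vA2 : vp p (taylor_coef f s 2) = (0%:R)%:E. Proof. exact: vp_unit. Qed.
Let vA3 : vp p (taylor_coef f s 3) = (0%:R)%:E. Proof. exact: vp_unit. Qed.
Let vA4 : vp p (taylor_coef f s 4) = (0%:R)%:E. Proof. exact: vp_unit. Qed.

Let hull_ge (x y : rat) : in_hull p f s x y ->
  [/\ 0 <= x, 0 <= y & M%:R * (2 - x) <= y].
Proof.
rewrite /in_hull sf => -[t [t0 _ t1 -> ->]].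
move: t1; rewrite !big_ord_recl !big_ord0 /= /bump /= => t1.
rewrite vA0 vA1 vA2 vA3 vA4 /= -!muln2 natrM.
have t0' := t0 ord0.
have t1' := t0 (lift ord0 ord0).
have t2' := t0 (lift ord0 (lift ord0 ord0)).
have t3' := t0 (lift ord0 (lift ord0 (lift ord0 ord0))).
have t4' := t0 (lift ord0 (lift ord0 (lift ord0 (lift ord0 ord0)))).
move: t1 t0' t1' t2' t3' t4'.
set x0 := t _; set x1 := t _; set x2 := t _; set x3 := t _; set x4 := t _.
move=> t1 ? ? ? ? ?; have M0' : 0 <= M%:R :> rat by [].
have ? : 0 <= M%:R * x3 by apply: mulr_ge0.
have ? : 0 <= M%:R * x4 by apply: mulr_ge0.
have ? : 0 <= M%:R * x0 by apply: mulr_ge0.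
have ? : 0 <= M%:R * x1 by apply: mulr_ge0.
split.
- by lra.
- by lra.
have E : M%:R * (x0 + (x1 + (x2 + (x3 + (x4 + 0))))) = M%:R :> rat by rewrite t1 mulr1.
by lra.
Qed.

Let side_env (x y : rat) :
  on_segment (0, M.*2%:R) (2, 0) x y -> on_envelope p f s x y.
Proof.
move=> [t [/andP[t0 t1] /= -> ->]].
have E : M.*2%:R = M%:R * 2 :> rat by rewrite -muln2 natrM.
split; last first.
  by move=> y' /hull_ge[_ _]; apply: le_trans; rewrite E; lra.
rewrite /in_hull sf.
exists (fun i : 'I_5 => if val i == 0%N then 1 - t else if val i == 2%N then t else 0).
split.
- by move=> i; case: ifP => _; [rewrite subr_ge0|case: ifP].
- move=> i; case: i => -[|[|[|[|[|//]]]]] ? /=; rewrite ?vA0 ?vA2 //.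
- by rewrite !big_ord_recl !big_ord0 /=; ring.
- by rewrite !big_ord_recl !big_ord0 /= /bump /=; ring.
by rewrite !big_ord_recl !big_ord0 /= /bump /= vA0 vA1 vA2 vA3 vA4 /=; ring.
Qed.

Let env_uniq (x y y' : rat) : on_envelope p f s x y -> on_envelope p f s x y' -> y = y'.
Proof. by move=> [h m] [h' m']; apply/le_anti/andP; split; [apply: m|apply: m']. Qed.

Let the_side : is_side p f s (0, M.*2%:R) (2, 0).
Proof.
split; first by split=> //= x y; apply: side_env.
move=> [x1 y1] [x2 y2] [/= x12 env] x1_le x2_ge.
have e1 : on_envelope p f s x1 y1.
  by apply: env; exists 0; split=> //=; ring.
have e2 : on_envelope p f s x2 y2.
  by apply: env; exists 1; split=> //=; ring.
have x1_0 : x1 = 0.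
  by apply/le_anti; rewrite x1_le /=; case: e1 => /hull_ge[].
rewrite {}x1_0 in x12 env e1 *.
have y1E : y1 = M.*2%:R.
  by apply: env_uniq e1 _; apply: side_env; exists 0; split=> //=; ring.
have x2p : 0 < x2 by [].
have e0 : on_envelope p f s 2 ((1 - 2 / x2) * y1 + 2 / x2 * y2).
  apply: env; exists (2 / x2); split=> //=.
    by apply/andP; split; [rewrite divr_ge0 // ltW|rewrite ler_pdivrMr // mul1r].
  by field; rewrite gt_eqF.
have E0 : (1 - 2 / x2) * y1 + 2 / x2 * y2 = 0.
  by apply: env_uniq e0 _; apply: side_env; exists 1; split=> //=; ring.
have x2E : x2 = 2.
  apply/le_anti; rewrite x2_ge andbT leNgt; apply/negP => x2_gt.
  have y2_ge : 0 <= y2 by case: e2 => /hull_ge[].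
  have lt1 : 2 / x2 < 1 by rewrite ltr_pdivrMr // mul1r.
  have y1p : 0 < y1 by rewrite y1E ltr0n double_gt0.
  have : 0 < (1 - 2 / x2) * y1 + 2 / x2 * y2.
    apply: ltr_pwDl; first by rewrite mulr_gt0 // subr_gt0.
    by rewrite mulr_ge0 // divr_ge0 // ltW.
  by rewrite E0 ltxx.
rewrite x2E y1E; split=> //; congr pair.
by move: E0; rewrite x2E => <-; field.
Qed.

Let Nminus_at (i : nat) (y : rat) : (i < 3)%N -> y = M%:R * (2 - i%:R) ->
  on_Nminus p f s i%:R y.
Proof.
move=> i3 ->; exists (0, M.*2%:R), (2, 0); split=> //=.
  by rewrite ltr0n double_gt0.
exists (i%:R / 2); split=> /=.
- by apply/andP; split; [rewrite divr_ge0|rewrite ler_pdivrMr // mul1r ler_nat -ltnS].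
- by field.
- by rewrite -muln2 natrM; field.
Qed.

Let res_at (i : nat) k (m : int) : (i < 3)%N -> ~~ (p%:Z %| m)%Z ->
  A i = p%:Z ^+ k * m -> (k%:R = M%:R * (2 - i%:R) :> rat) ->
  res_coef p f s i = m%:~R.
Proof.
move=> i3 pm Ai kE.
have v := vp_pmul k p_pr pm.
rewrite /res_coef -/(A i) Ai v; case: asboolP => [_|[]]; last first.
  by exists k%:R => //; apply: Nminus_at.
have p0 := prime_gt0 p_pr.
have -> : logn p `|p%:Z ^+ k * m| = k.
  move: v; rewrite /vp; case: eqP => // _ [/eqP]; rewrite eqr_nat => /eqP; exact.
rewrite -[(p ^ k)%N%:Z]natz natrX natz mulKz //.
by rewrite expf_eq0 eqz_nat (gtn_eqF p0) andbF.
Qed.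

(** The polygon at s is the segment from (0, 2M) to (2, 0), with the residual
    polynomial a0 + a1 y + A2 y^2; regularity forbids it a double root. *)
Lemma regular_one_side : regular_at p f s ->
  (2 < p)%N -> ~~ (p%:Z %| a1 ^+ 2 - 4 * a0 * A 2)%Z.
Proof.
move=> reg p2; apply/negP.
rewrite -Fp_intr_eq0 // rmorphB !rmorphM /= subr_eq0 -expr2 => /eqP sq.
have two : (2 : 'F_p) != 0.
  by rewrite -[2](mulrz_nat) Fp_intr_eq0 // dvdzE /= gtnNdvd.
have a20 : (A 2)%:~R != 0 :> 'F_p by rewrite Fp_intr_eq0.
have r0 : res_coef p f s 0 = a0%:~R.
  by apply: res_at A0 _ => //; rewrite -muln2 natrM; ring.
have r1 : res_coef p f s 1 = a1%:~R.
  by apply: res_at A1 _ => //; ring.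
have r2 : res_coef p f s 2 = (A 2)%:~R.
  by apply: (@res_at _ 0) => //; rewrite ?mul1r //; ring.
have side' : is_side p f s (0%N%:R, M.*2%:R)
    ((0 + 2 * 1)%N%:R, M.*2%:R - (2 * M)%N%:R).
  by rewrite [(2 * M)%N]mul2n subrr; apply: the_side.
have := reg 0%N 2%N 1%N M _ M0 isT (coprimen1 _) side'.
rewrite separable_poly.unlock => cop.
have [x [e0 e1]] := quadratic_double_root two a20 sq.
have PE : residual_poly p f s 0 2 1 =
  a0%:~R%:P + a1%:~R *: 'X + (A 2)%:~R *: 'X^2.
  apply/polyP => i; rewrite coef_poly !coefE /=.
  case: i => [|[|[|i]]] /=; rewrite ?r0 ?r1 ?r2 /=; ring.
have rP : root (residual_poly p f s 0 2 1) x.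
  rewrite /root PE !hornerE /=; apply/eqP.
  by rewrite -mulrA -expr2.
have := coprimep_root cop rP.
rewrite PE !derivE !hornerE /=; apply/negP; rewrite negbK; apply/eqP.
by apply: etrans e1; ring.
Qed.

End OneSide.

(** * Approximate factorization of the quartic *)

Lemma horner_Taylor2 (P : {poly int}) (x h : int) :
  exists q, P.[x + h] = P.[x] + P^`().[x] * h + h ^+ 2 * q.
Proof.
elim/poly_ind: P => [|P c [q IH]]; first by exists 0; rewrite deriv0 !horner0; ring.
exists (P^`().[x] + q * (x + h)).
by rewrite derivMXaddC !hornerE IH; ring.
Qed.

(** Newton's step: t + p^(N+1) k kills one more power of p when k solves a linear
    congruence, solvable since P'(t) is prime to p. *)
Lemma hensel p (P : {poly int}) (s : int) : prime p ->
  (p%:Z %| P.[s])%Z -> ~~ (p%:Z %| P^`().[s])%Z ->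
  forall N, exists2 t, (p%:Z %| s - t)%Z & (p%:Z ^+ N %| P.[t])%Z.
Proof.
move=> p_pr Ps P's; case=> [|N]; first by exists s; rewrite ?subrr ?dvdz0 // expr0 dvd1z.
elim: N => [|N [t st Pt]]; first by exists s; rewrite ?subrr ?dvdz0.
have P't : ~~ (p%:Z %| P^`().[t])%Z.
  apply: contra P's => P't; have [q qE] := horner_Taylor2 P^`() t (s - t).
  move: qE; rewrite addrC subrK => ->.
  rewrite expr2 -mulrA rpredD //; last by apply: dvdz_mulr.
  by rewrite rpredD //; apply: dvdz_mull.
have /coprimezP[[u v] /= uv] : coprimez p (P^`().[t]).
  by rewrite coprimezE prime_coprime.
case/dvdzP: Pt => m Pt.
(* v inverts P'(t) modulo p *)
pose h := p%:Z ^+ N.+1 * (- m * v).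
have [q qE] := horner_Taylor2 P t h.
exists (t + h).
  by rewrite opprD addrA rpredB // /h exprS -mulrA dvdz_mulr.
rewrite qE rpredD //.
  have -> : P.[t] + P^`().[t] * h = p%:Z ^+ N.+2 * (m * u).
    rewrite Pt /h [in RHS]exprSr.
    transitivity (p%:Z ^+ N.+1 * m * (1 - v * P^`().[t])); first by ring.
    by rewrite -uv; ring.
  by rewrite dvdz_mulr.
rewrite dvdz_mulr // /h exprMn dvdz_mulr // -exprM dvdz_exp2l //; lia.
Qed.

(** Up to sign, this is the resolvent cubic z^3 + 2 a z^2 + (a^2 - 4 c) z - b^2 of the
    quartic, at z = 4 t^2. *)
Definition resolvent (a b c t : int) : int :=
  b ^+ 2 - 64 * t ^+ 6 - 32 * a * t ^+ 4 - 4 * t ^+ 2 * (a ^+ 2 - 4 * c).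

(** For the factorization ((x - t)^2 - d1) ((x + t)^2 - d2) of the quartic, the
    coefficients a and b force 4 t d1 to be this integer; exchanging the factors
    changes t to - t, and so [local_disc a b (- t)] is - 4 t d2. *)
Definition local_disc (a b t : int) : int := - (2 * t * a + 4 * t ^+ 3 + b).

(** The two factors reproduce the coefficients a and b, and the resolvent is the
    error in the constant term, times 16 t^2. *)
Lemma near_factor (a b c t x : int) :
  16 * t ^+ 2 * (x ^+ 4 + a * x ^+ 2 + b * x + c) =
  (4 * t * (x - t) ^+ 2 - local_disc a b t) *
  (4 * t * (x + t) ^+ 2 + local_disc a b (- t)) + resolvent a b c t.
Proof. by rewrite /local_disc /resolvent; ring. Qed.

(** The first term on the right is (4 t)^6 times the discriminant of the product of
    the two approximate factors, whose discriminants are 4 d1 and 4 d2; the squared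
    polynomial is 4 t^2 times their resultant. The identity is one of polynomials in
    b^2, and q is the quotient by the resolvent, which has degree 1 in b^2. *)
Lemma disc_near_factor (a b c t : int) : exists q,
  (4 * t) ^+ 6 * (16 * a ^+ 4 * c - 4 * a ^+ 3 * b ^+ 2 - 128 * a ^+ 2 * c ^+ 2
    + 144 * a * b ^+ 2 * c - 27 * b ^+ 4 + 256 * c ^+ 3) =
  - 256 * (local_disc a b t * local_disc a b (- t)) *
    (128 * t ^+ 6 + 32 * a * t ^+ 4 + b ^+ 2) ^+ 2 + resolvent a b c t * q.
Proof.
pose W := (2 * t * a + 4 * t ^+ 3) ^+ 2; pose S := 128 * t ^+ 6 + 32 * a * t ^+ 4.
pose B := b ^+ 2; pose K := 64 * t ^+ 6 + 32 * a * t ^+ 4 + 4 * t ^+ 2 * (a ^+ 2 - 4 * c).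
(* With resolvent B - K, each power B^i - K^i is divided by B - K. *)
exists (256 * (B ^+ 2 + B * K + K ^+ 2)
  + (- 27 * 4096 * t ^+ 6 - 256 * (W - 2 * S)) * (B + K)
  + (4096 * t ^+ 6 * (144 * a * c - 4 * a ^+ 3) - 256 * (2 * S * W - S ^+ 2))).
by rewrite /local_disc /resolvent /B /K /W /S; ring.
Qed.

(** * Local indices and the exponents of the basis *)

Definition quartic (a b c : int) : {poly int} :=
  'X^4 + a *: 'X^2 + b *: 'X + c%:P.

Lemma horner_quartic (a b c x : int) :
  (quartic a b c).[x] = x ^+ 4 + a * x ^+ 2 + b * x + c.
Proof. by rewrite /quartic !hornerE /=; ring. Qed.

Lemma horner_deriv_quartic (a b c x : int) :
  (quartic a b c)^`().[x] = 4 * x ^+ 3 + 2 * a * x + b.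
Proof. by rewrite /quartic !derivE !hornerE /=; ring. Qed.

Lemma taylor2_quartic (a b c s : int) : taylor_coef (quartic a b c) s 2 = 6 * s ^+ 2 + a.
Proof.
rewrite /taylor_coef.
have -> : (quartic a b c)^`N(2) = 6 *: 'X^2 + a%:P.
  apply/polyP => i; rewrite coef_nderivn /quartic quartic_polyseq coef_Poly !coefE.
  by case: i => [|[|[|i]]] /=; rewrite ?nth_nil ?mul0rn ?mulr0 ?addr0 ?mulr1 ?add0r //.
by rewrite !hornerE /=; ring.
Qed.

Lemma taylor3_quartic (a b c s : int) : taylor_coef (quartic a b c) s 3 = 4 * s.
Proof.
rewrite /taylor_coef.
have -> : (quartic a b c)^`N(3) = 4 *: 'X.
  apply/polyP => i; rewrite coef_nderivn /quartic quartic_polyseq coef_Poly !coefE.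
  by case: i => [|[|i]] /=; rewrite ?nth_nil ?mul0rn ?mulr0 ?addr0 ?mulr1 ?add0r //.
by rewrite !hornerE.
Qed.

Lemma taylor4_quartic (a b c s : int) : taylor_coef (quartic a b c) s 4 = 1.
Proof.
rewrite /taylor_coef.
have -> : (quartic a b c)^`N(4) = 1.
  apply/polyP => i; rewrite coef_nderivn /quartic quartic_polyseq coef_Poly !coefE.
  by case: i => [|i] /=; rewrite ?nth_nil ?mul0rn ?mulr0 ?addr0 ?mulr1 ?add0r //.
by rewrite hornerE.
Qed.

Section TwoDoubleRoots.
Variables (p : nat) (a b c : int).
Hypotheses (p_pr : prime p) (p_gt2 : (2 < p)%N).

Lemma dvdz_cong (d x y : int) : (d %| x - y)%Z -> (d %| x)%Z = (d %| y)%Z.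
Proof. by move=> h; rewrite -(subrK y x) rpredDl. Qed.

Lemma p_ndvd2X k : ~~ (p%:Z %| 2 ^+ k)%Z.
Proof. by apply: Euclid_dvdzX => //; rewrite dvdzE /= gtnNdvd. Qed.

(** This says that the quartic is (x - s)^2 (x + s)^2 modulo p, with s and - s distinct
    because p is odd. *)
Record double_roots (s : int) : Prop := DoubleRoots {
  dr_s : ~~ (p%:Z %| s)%Z;
  dr_a : (p%:Z %| a + 2 * s ^+ 2)%Z;
  dr_b : (p%:Z %| b)%Z;
  dr_c : (p%:Z %| c - s ^+ 4)%Z }.

Lemma double_rootsN s : double_roots s -> double_roots (- s).
Proof. by case=> *; split; rewrite ?sqrrN ?dvdzE ?abszN // -dvdzE exprNn mul1r. Qed.

(** Modulo p the derivative of the resolvent at s is - 128 s^5, a unit. *)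
Lemma resolvent_root s N : double_roots s ->
  exists2 t, (p%:Z %| s - t)%Z & (p%:Z ^+ N %| resolvent a b c t)%Z.
Proof.
case=> ps pa pb pc.
pose P : {poly int} := (b ^+ 2)%:P - 64 *: 'X^6 - (32 * a) *: 'X^4
  - (4 * (a ^+ 2 - 4 * c)) *: 'X^2.
have PE t : P.[t] = resolvent a b c t.
  by rewrite /P /resolvent !hornerE /=; ring.
have P'E t : P^`().[t] =
   - 384 * t ^+ 5 - 128 * a * t ^+ 3 - 8 * (a ^+ 2 - 4 * c) * t.
  by rewrite /P !derivE !hornerE /=; ring.
have [] := @hensel p P s p_pr _ _ N.
- rewrite PE /resolvent.
  have -> : b ^+ 2 - 64 * s ^+ 6 - 32 * a * s ^+ 4 - 4 * s ^+ 2 * (a ^+ 2 - 4 * c) =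
    b * b + (a + 2 * s ^+ 2) * (- 24 * s ^+ 4 - 4 * s ^+ 2 * a)
      + (c - s ^+ 4) * (16 * s ^+ 2) by ring.
  by rewrite !rpredD // dvdz_mulr.
- rewrite P'E (@dvdz_cong _ _ (- 2 ^+ 7 * s ^+ 5)).
    by rewrite mulNr rpredN Euclid_dvdzM // negb_or p_ndvd2X Euclid_dvdzX.
  have -> : - 384 * s ^+ 5 - 128 * a * s ^+ 3 - 8 * (a ^+ 2 - 4 * c) * s -
      - 2 ^+ 7 * s ^+ 5 =
    (a + 2 * s ^+ 2) * (- 112 * s ^+ 3 - 8 * a * s) + (c - s ^+ 4) * (32 * s) by ring.
  by rewrite !rpredD // dvdz_mulr.
by move=> t st Pt; exists t; rewrite // -PE.
Qed.

Lemma p_dvd_local_disc s t : double_roots s -> (p%:Z %| s - t)%Z ->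
  (p%:Z %| local_disc a b t)%Z.
Proof.
case=> ps pa pb pc st; rewrite /local_disc.
have -> : - (2 * t * a + 4 * t ^+ 3 + b) =
  (a + 2 * s ^+ 2) * (- 2 * t) + (s - t) * (4 * t * (s + t)) - b by ring.
by rewrite rpredB // rpredD // dvdz_mulr.
Qed.

(** With tau = s - t, f(s) is a unit times 4 t tau^2 - D modulo the resolvent, where D
    is the local discriminant, and f'(s) is a unit times tau modulo this. So p^M
    divides tau and p^(2M) divides D. If p^(2M+2) divided D, then v(tau) would be
    exactly M, the point (1, M) would lie on the side from (0, 2M) to (2, 0), and the
    residual polynomial would be a constant times the square of y + tau / p^M. *)
Lemma local_index s t M : double_roots s -> (p%:Z %| s - t)%Z ->
  regular_at p (quartic a b c) s ->
  (p%:Z ^+ M.*2 %| (quartic a b c).[s])%Z ->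
  (p%:Z ^+ M %| (quartic a b c)^`().[s])%Z ->
  ~ ((p%:Z ^+ M.*2.+2 %| (quartic a b c).[s])%Z /\
     (p%:Z ^+ M.+1 %| (quartic a b c)^`().[s])%Z) ->
  (p%:Z ^+ M.*2.+2 %| resolvent a b c t)%Z ->
  [/\ (p%:Z ^+ M %| s - t)%Z, (p%:Z ^+ M.*2 %| local_disc a b t)%Z
    & ~~ (p%:Z ^+ M.*2.+2 %| local_disc a b t)%Z].
Proof.
move=> dr pst reg pA0 pA1 maxM pH; have [ps pa pb pc] := dr.
set A0 := _.[s] in pA0 maxM; set A1 := _.[s] in pA1 maxM.
set H := resolvent a b c t in pH *; set D := local_disc a b t.
set tau := s - t in pst *.
pose U := 4 * t * (s + t) ^+ 2 + local_disc a b (- t).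
pose V := 4 * t * tau ^+ 2 - D.
have A0E : 16 * t ^+ 2 * A0 = V * U + H.
  by rewrite /A0 horner_quartic (near_factor a b c t).
have A1E : 16 * t ^+ 2 * A1 = 8 * t * tau * U + V * (8 * t * (s + t)).
  rewrite /A1 horner_deriv_quartic /U /V /D /tau /local_disc; ring.
have pt : ~~ (p%:Z %| t)%Z by rewrite -(dvdz_cong pst).
have pD2 : (p%:Z %| local_disc a b (- t))%Z.
  apply: (p_dvd_local_disc (double_rootsN dr)).
  by rewrite opprK addrC -opprB rpredN.
have p2 k n : ~~ (p%:Z %| 2 ^+ k * t ^+ n)%Z.
  by rewrite Euclid_dvdzM // negb_or p_ndvd2X Euclid_dvdzX.
pose xU := U - 2 ^+ 4 * t ^+ 3.
have xUp : (p%:Z %| xU)%Z.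
  have -> : xU = local_disc a b (- t) + tau * (4 * t * (tau + 4 * t)).
    by rewrite /xU /U /tau; ring.
  by rewrite rpredD // dvdz_mulr.
have pU : ~~ (p%:Z %| U)%Z.
  by rewrite (dvdz_cong xUp).
have p16 k z : (p%:Z ^+ k %| 16 * t ^+ 2 * z)%Z = (p%:Z ^+ k %| z)%Z.
  by rewrite Gauss_dvdzX // (_ : 16 = 2 ^+ 4).
have p8U k : (p%:Z ^+ k %| 8 * t * tau * U)%Z = (p%:Z ^+ k %| tau)%Z.
  have -> : 8 * t * tau * U = (2 ^+ 3 * t ^+ 1 * U) * tau by ring.
  by rewrite Gauss_dvdzX // Euclid_dvdzM // negb_or p2.
have pV k : (k <= M.*2.+2)%N -> (p%:Z ^+ k %| A0)%Z = (p%:Z ^+ k %| V)%Z.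
  move=> kM; rewrite -p16 A0E rpredDr; last exact: dvdz_dvdXn pH.
  by rewrite mulrC Gauss_dvdzX.
have pV2 : (p%:Z ^+ M.*2 %| V)%Z by rewrite -pV //; lia.
have ptau : (p%:Z ^+ M %| tau)%Z.
  rewrite -p8U (_ : 8 * _ * _ * _ = 16 * t ^+ 2 * A1 - V * (8 * t * (s + t))).
    rewrite rpredB ?p16 //.
    by rewrite dvdz_mulr // (dvdz_dvdXn _ pV2) // -addnn leq_addr.
  by rewrite A1E addrK.
have ptau2 k : (p%:Z ^+ k %| tau)%Z -> (p%:Z ^+ k.*2 %| 4 * t * tau ^+ 2)%Z.
  by move=> h; rewrite dvdz_mull // -muln2 exprM dvdz_exp2r.
have pD : (p%:Z ^+ M.*2 %| D)%Z.
  have -> : D = 4 * t * tau ^+ 2 - V by rewrite /V; ring.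
  by rewrite rpredB // ptau2.
split=> //; apply/negP => pD'.
have ptau' : ~~ (p%:Z ^+ M.+1 %| tau)%Z.
  apply/negP => h; apply: maxM.
  have hV : (p%:Z ^+ M.*2.+2 %| V)%Z by rewrite rpredB // (ptau2 _ h).
  rewrite pV // hV; split=> //; rewrite -p16 A1E rpredD ?p8U //.
  by rewrite dvdz_mulr // (dvdz_dvdXn _ hV) //; lia.
(* From here on v(tau) = M; a0, a1 are f(s), f'(s) without their powers of p. *)
have M0 : (0 < M)%N by case: (M) ptau' => //; rewrite expr1 pst.
case/dvdzP: ptau => tau' tauE.
have ptau0 : ~~ (p%:Z %| tau')%Z.
  by apply: contra ptau' => h; rewrite tauE exprS dvdz_mul.
case/dvdzP: pA0 => a0 a0E; case/dvdzP: pA1 => a1 a1E.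
case/dvdzP: pD' => d dE; case/dvdzP: pH => h hE.
have p0 : p%:Z != 0 by rewrite eqz_nat -lt0n prime_gt0.
have pX0 k : p%:Z ^+ k != 0 by rewrite expf_neq0.
have pM : p%:Z ^+ M.*2 = p%:Z ^+ M * p%:Z ^+ M by rewrite -exprD addnn.
have pM2 : p%:Z ^+ M.*2.+2 = p%:Z ^+ M * p%:Z ^+ M * p%:Z ^+ 2.
  by rewrite -!exprD addnn addn2.
have e0 : 16 * t ^+ 2 * a0 = (4 * t * tau' ^+ 2 - d * p%:Z ^+ 2) * U + h * p%:Z ^+ 2.
  apply: (mulfI (pX0 M.*2)).
  have -> : p%:Z ^+ M.*2 * (16 * t ^+ 2 * a0) = 16 * t ^+ 2 * A0 by rewrite a0E; ring.
  by rewrite A0E /V tauE dE hE pM2 pM; ring.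
have e1 : 16 * t ^+ 2 * a1 = 8 * t * tau' * U +
    p%:Z ^+ M * ((4 * t * tau' ^+ 2 - d * p%:Z ^+ 2) * (8 * t * (s + t))).
  apply: (mulfI (pX0 M)).
  have -> : p%:Z ^+ M * (16 * t ^+ 2 * a1) = 16 * t ^+ 2 * A1 by rewrite a1E; ring.
  by rewrite A1E /V tauE dE pM2; ring.
have x0 : (p%:Z %| a0 - 2 ^+ 2 * t ^+ 2 * tau' ^+ 2)%Z.
  have /(Gauss_dvdzX p_pr 1) <- := p2 4%N 2%N.
  rewrite expr1.
  have -> : 2 ^+ 4 * t ^+ 2 * (a0 - 2 ^+ 2 * t ^+ 2 * tau' ^+ 2) =
    xU * (4 * t * tau' ^+ 2) + p%:Z * (h * p%:Z - d * p%:Z * U) :> int.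
    transitivity (16 * t ^+ 2 * a0 - 64 * t ^+ 4 * tau' ^+ 2); first by ring.
    by rewrite e0 /xU; ring.
  by rewrite rpredD // dvdz_mulr.
have x1 : (p%:Z %| a1 - 2 ^+ 3 * t ^+ 2 * tau')%Z.
  have /(Gauss_dvdzX p_pr 1) <- := p2 4%N 2%N.
  rewrite expr1.
  have -> : 2 ^+ 4 * t ^+ 2 * (a1 - 2 ^+ 3 * t ^+ 2 * tau') =
    xU * (8 * t * tau') + p%:Z ^+ M * ((4 * t * tau' ^+ 2 - d * p%:Z ^+ 2) * (8 * t * (s + t))).
    transitivity (16 * t ^+ 2 * a1 - 128 * t ^+ 4 * tau'); first by ring.
    by rewrite e1 /xU; ring.
  by rewrite rpredD // dvdz_mulr // dvdz_exp.
have x2 : (p%:Z %| taylor_coef (quartic a b c) s 2 - 4 * t ^+ 2)%Z.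
  rewrite taylor2_quartic.
  have -> : 6 * s ^+ 2 + a - 4 * t ^+ 2 = (a + 2 * s ^+ 2) + tau * (4 * (s + t)).
    by rewrite /tau; ring.
  by rewrite rpredD // dvdz_mulr.
have : ~~ (p%:Z %| a1 ^+ 2 - 4 * a0 * taylor_coef (quartic a b c) s 2)%Z.
  apply: (@regular_one_side p (quartic a b c) s M) => //.
  - exact: size_quartic.
  - by rewrite /taylor_coef nderivn0 mulrC -a0E.
  - by rewrite /taylor_coef nderivn1 mulrC -a1E.
  - by rewrite (dvdz_cong x0) Euclid_dvdzM // negb_or p2 Euclid_dvdzX.
  - by rewrite (dvdz_cong x1) Euclid_dvdzM // negb_or p2.
  - by rewrite (dvdz_cong x2) (_ : 4 = 2 ^+ 2).
  - have p4s : ~~ (p%:Z %| 2 ^+ 2 * s)%Z by rewrite Euclid_dvdzM // negb_or p_ndvd2X.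
    by rewrite taylor3_quartic.
  by rewrite taylor4_quartic; have := p_ndvd2X 0; rewrite expr0.
apply/negP; rewrite negbK.
set A2 := taylor_coef _ _ _ in x2 *.
have -> : a1 ^+ 2 - 4 * a0 * A2 =
  (a1 - 2 ^+ 3 * t ^+ 2 * tau') * (a1 + 2 ^+ 3 * t ^+ 2 * tau')
  - (a0 - 2 ^+ 2 * t ^+ 2 * tau' ^+ 2) * (4 * A2)
  - (A2 - 4 * t ^+ 2) * (16 * t ^+ 2 * tau' ^+ 2) by ring.
by rewrite !rpredB // dvdz_mulr.
Qed.

(** An integer t that is N-close to the p-adic centre of the factor at s, with what is
    known of the two local discriminants. *)
Record near_split (s : int) (M m N : nat) (t : int) : Prop := NearSplit {
  ns_st : (p%:Z %| s - t)%Z;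
  ns_t : ~~ (p%:Z %| t)%Z;
  ns_res : (p%:Z ^+ N %| resolvent a b c t)%Z;
  ns_M : (p%:Z ^+ M %| s - t)%Z;
  ns_p1 : (p%:Z %| local_disc a b t)%Z;
  ns_p2 : (p%:Z %| local_disc a b (- t))%Z;
  ns_d1 : (p%:Z ^+ M.*2 %| local_disc a b t)%Z;
  ns_d1' : ~~ (p%:Z ^+ M.*2.+2 %| local_disc a b t)%Z;
  ns_d2 : (p%:Z ^+ m.*2 %| local_disc a b (- t))%Z;
  ns_d2' : ~~ (p%:Z ^+ m.*2.+2 %| local_disc a b (- t))%Z }.

(** This characterizes M = floor (min (v(f(s)) / 2, v(f'(s)))). *)
Definition index_at (s : int) (M : nat) : Prop :=
  [/\ (p%:Z ^+ M.*2 %| (quartic a b c).[s])%Z,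
      (p%:Z ^+ M %| (quartic a b c)^`().[s])%Z
    & ~ ((p%:Z ^+ M.*2.+2 %| (quartic a b c).[s])%Z /\
         (p%:Z ^+ M.+1 %| (quartic a b c)^`().[s])%Z)].

Lemma near_split_exists s M m N : double_roots s ->
  regular_at p (quartic a b c) s -> regular_at p (quartic a b c) (- s) ->
  index_at s M -> index_at (- s) m -> exists t, near_split s M m N t.
Proof.
move=> dr reg reg' [M0 M1 Mmax] [m0 m1 mmax].
(* The precision serves [local_index] at s and at - s as well. *)
have [t st tH] := resolvent_root (N + M.*2.+2 + m.*2.+2) dr.
have drN := double_rootsN dr.
have stN : (p%:Z %| - s - - t)%Z by rewrite opprK addrC -opprB rpredN.
have HN : resolvent a b c (- t) = resolvent a b c t by rewrite /resolvent; ring.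
have h k : (k <= N + M.*2.+2 + m.*2.+2)%N -> (p%:Z ^+ k %| resolvent a b c t)%Z.
  by move=> hk; apply: dvdz_dvdXn tH.
have [x1 x2 x3] : [/\ (p%:Z ^+ M %| s - t)%Z, (p%:Z ^+ M.*2 %| local_disc a b t)%Z
    & ~~ (p%:Z ^+ M.*2.+2 %| local_disc a b t)%Z].
  by apply: (local_index dr st reg M0 M1 Mmax); apply: h; clear; lia.
have [_ y2 y3] : [/\ (p%:Z ^+ m %| - s - - t)%Z,
    (p%:Z ^+ m.*2 %| local_disc a b (- t))%Z
    & ~~ (p%:Z ^+ m.*2.+2 %| local_disc a b (- t))%Z].
  by apply: (local_index drN stN reg' m0 m1 mmax); rewrite HN; apply: h; clear; lia.
exists t; split=> //.
- by rewrite -(dvdz_cong st); case: dr.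
- by apply: h; clear; lia.
- exact: p_dvd_local_disc st.
- exact: p_dvd_local_disc stN.
Qed.

Lemma local_disc_valuation M (D : int) :
  (p%:Z ^+ M.*2 %| D)%Z -> ~~ (p%:Z ^+ M.*2.+2 %| D)%Z ->
  exists k, [/\ k %/ 2 = M, (p%:Z ^+ k %| D)%Z & ~~ (p%:Z ^+ k.+1 %| D)%Z]%N.
Proof.
move=> h h'; have [h1|h1] := boolP (p%:Z ^+ M.*2.+1 %| D)%Z.
  by exists M.*2.+1; split=> //; rewrite -muln2 -addn1 divnMDl // addn0.
by exists M.*2; split=> //; rewrite -muln2 mulnK.
Qed.

(** If k1 and k2 are the valuations of the local discriminants, then Delta = k1 + k2
    and r = min (k1, k2), while M and m are the halves of k1 and k2, rounded down. As
    m <= M, the half of the minimum is m and the half of the maximum is M. *)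
Lemma nu_values s M m : double_roots s ->
  regular_at p (quartic a b c) s -> regular_at p (quartic a b c) (- s) ->
  index_at s M -> index_at (- s) m -> (m <= M)%N ->
  let Delta := vp p (monic_disc (quartic a b c)) in
  let r := Order.min (vp p b) (vp p (a ^+ 2 - 4 * c)) in
  Num.floor (fine r / 2) = m /\ Num.floor (fine (Delta - r)%E / 2) = M.
Proof.
move=> dr reg reg' iM im mM.
have [t [st pt pH _ _ _ d1 d1' d2 d2']] :=
  near_split_exists (M.*2.+2 + m.*2.+2) dr reg reg' iM im.
have {d1 d1'} [k1 [k1M d1 d1']] := local_disc_valuation d1 d1'.
have {d2 d2'} [k2 [k2m d2 d2']] := local_disc_valuation d2 d2'.
set D1 := local_disc a b t in d1 d1'; set D2 := local_disc a b (- t) in d2 d2'.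
(* Precision 2M + 2m + 4 exceeds v(D1) + v(D2) <= 2M + 2m + 2. *)
set H := resolvent a b c t in pH; set N := (_ + _)%N in pH.
have kN : (k1 + k2 < N)%N.
  have [] := (divn_eq k1 2, divn_eq k2 2).
  have [] := (ltn_pmod k1 (isT : 0 < 2)%N, ltn_pmod k2 (isT : 0 < 2)%N).
  by rewrite /N k1M k2m; clear; lia.
have kminN : (minn k1 k2 < N)%N by move: kN; clear; lia.
have kminE : (minn k1 k2 %/ 2 = m)%N by move: k1M k2m mM; clear; lia.
have kmaxE : ((k1 + k2 - minn k1 k2) %/ 2 = M)%N by move: k1M k2m mM; clear; lia.
have kmin_le : (minn k1 k2 <= k1 + k2)%N by clear; lia.
have pHk k : (k <= N)%N -> (p%:Z ^+ k %| H)%Z by move=> h; apply: dvdz_dvdXn pH.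
have p2 k n : ~~ (p%:Z %| 2 ^+ k * t ^+ n)%Z.
  by rewrite Euclid_dvdzM // negb_or p_ndvd2X Euclid_dvdzX.
have dvdX2 k z : (p%:Z ^+ k %| 2 * z)%Z = (p%:Z ^+ k %| z)%Z.
  by rewrite Gauss_dvdzX //; apply: (p_ndvd2X 1).
have pair k : (k <= N)%N -> ((p%:Z ^+ k %| b)%Z /\ (p%:Z ^+ k %| a ^+ 2 - 4 * c)%Z) <->
    ((p%:Z ^+ k %| D1)%Z /\ (p%:Z ^+ k %| D2)%Z).
  move=> hk; pose W := 2 * t * a + 4 * t ^+ 3; have hH := pHk k hk.
  have D1E : D1 = - (W + b) by rewrite /D1 /local_disc /W; ring.
  have D2E : D2 = W - b by rewrite /D2 /local_disc /W; ring.
  have WE : 2 ^+ 4 * t ^+ 3 * W = b * b - H - 2 ^+ 2 * t ^+ 2 * (a ^+ 2 - 4 * c).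
    by rewrite /W /H /resolvent; ring.
  split=> -[h1 h2].
    have hW : (p%:Z ^+ k %| W)%Z.
      rewrite -(Gauss_dvdzX p_pr k W (p2 4%N 3%N)) WE.
      by apply: rpredB; [apply: rpredB => //|]; apply: dvdz_mull.
    by rewrite D1E D2E rpredN rpredD ?rpredB.
  have hb : (p%:Z ^+ k %| b)%Z.
    rewrite -dvdX2 (_ : 2 * b = - (D1 + D2)); last by rewrite D1E D2E; ring.
    by rewrite rpredN rpredD.
  have hW : (p%:Z ^+ k %| W)%Z by rewrite -(subrK b W) -D2E rpredD.
  split=> //; rewrite -(Gauss_dvdzX p_pr k _ (p2 2%N 2%N)).
  have -> : 2 ^+ 2 * t ^+ 2 * (a ^+ 2 - 4 * c) = b * b - H - 2 ^+ 4 * t ^+ 3 * W.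
    by rewrite WE; ring.
  by apply: rpredB; [apply: rpredB => //|]; apply: dvdz_mull.
have rE : Order.min (vp p b) (vp p (a ^+ 2 - 4 * c)) = ((minn k1 k2)%:R)%:E.
  have [] := (pair (minn k1 k2) (ltnW kminN)).2 _.
    by split; [apply: dvdz_dvdXn d1|apply: dvdz_dvdXn d2]; rewrite ?geq_minl ?geq_minr.
  move=> h1 h2; apply: vp_min_fin => // /(pair _ kminN)[].
  case: (leqP k1 k2) => _ h3 h4; [by rewrite h3 in d1'|by rewrite h4 in d2'].
pose P := 128 * t ^+ 6 + 32 * a * t ^+ 4 + b ^+ 2.
have pP : ~~ (p%:Z %| P)%Z.
  case: dr => _ pa pb _.
  rewrite (@dvdz_cong _ _ (2 ^+ 6 * t ^+ 6)) //.
  have -> : P - 2 ^+ 6 * t ^+ 6 = (a + 2 * s ^+ 2) * (32 * t ^+ 4) + b * b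
      - (s - t) * (64 * t ^+ 4 * (s + t)) by rewrite /P; ring.
  by rewrite rpredB ?rpredD // dvdz_mulr.
have pdisc k : (k <= N)%N ->
    (p%:Z ^+ k %| monic_disc (quartic a b c))%Z = (p%:Z ^+ k %| D1 * D2)%Z.
  move=> hk; have [q] := disc_near_factor a b c t; rewrite -disc_quartic -/P -/D1 -/D2 -/H.
  have u1 : ~~ (p%:Z %| (4 * t) ^+ 6)%Z.
    by rewrite (_ : 4 * t = 2 ^+ 2 * t ^+ 1) ?Euclid_dvdzX //; ring.
  have u2 : ~~ (p%:Z %| 2 ^+ 8 * P ^+ 2)%Z.
    by rewrite Euclid_dvdzM // negb_or p_ndvd2X Euclid_dvdzX.
  move=> E; rewrite -(Gauss_dvdzX p_pr k _ u1) E rpredDr; last by rewrite dvdz_mulr ?pHk.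
  rewrite -(Gauss_dvdzX p_pr k (D1 * D2) u2).
  have -> : - 256 * (D1 * D2) * P ^+ 2 = - (2 ^+ 8 * P ^+ 2 * (D1 * D2)) by ring.
  by rewrite rpredN.
have [c1 c1E] := dvdzP d1; have [c2 c2E] := dvdzP d2.
have DE : D1 * D2 = p%:Z ^+ (k1 + k2) * (c1 * c2) by rewrite exprD c1E c2E; ring.
have pc k D x : D = x * p%:Z ^+ k -> ~~ (p%:Z ^+ k.+1 %| D)%Z -> ~~ (p%:Z %| x)%Z.
  by move=> ->; apply: contra => h; rewrite exprS dvdz_mul.
have DeltaE : vp p (monic_disc (quartic a b c)) = ((k1 + k2)%:R)%:E.
  have [] := @lognE_dvd p p_pr (monic_disc (quartic a b c)) (k1 + k2).
  - by rewrite pdisc ?DE ?dvdz_mulr // ltnW.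
  - rewrite pdisc // DE exprSr; apply/negP.
    rewrite dvdz_mul2l; last by rewrite expf_neq0 // eqz_nat -lt0n prime_gt0.
    by apply/negP; rewrite Euclid_dvdzM // negb_or (pc _ _ _ c1E) ?(pc _ _ _ c2E).
  by move=> nz vE; rewrite vp_fin // vE.
rewrite /= DeltaE rE /= floor_half; split.
  by rewrite kminE.
by rewrite -natrB // floor_half kmaxE.
Qed.

End TwoDoubleRoots.

(** * The change of basis is invertible over Z_(p) *)

Ltac zloc p_pr := repeat match goal with
  | |- _ => assumption
  | |- in_Zloc _ (_ + - _) => apply (ZlocB p_pr)
  | |- in_Zloc _ (_ + _) => apply (ZlocD p_pr)
  | |- in_Zloc _ (- _) => apply (ZlocN p_pr)
  | |- in_Zloc _ (_ * _) => apply (ZlocM p_pr)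
  | |- in_Zloc _ (_ ^+ _) => apply (ZlocX p_pr)
  | |- in_Zloc _ (_ %:R) => apply (Zloc_nat p_pr)
  | |- in_Zloc _ (_ %:~R) => apply (Zloc_int p_pr)
  end.

(** Here PM = p^M, Pm = p^m, and [al1], [be1], [al2], [be2] are the coefficients of the
    residues, modulo the two factors, of the element with coordinates c0, ..., c3. The
    difference al1 - al2 expresses c1 by c2 and c3; what remains is a system of two
    equations for c2 and c3 with determinant - 8 t^3 modulo p. *)
Lemma Zloc_coords p (t : int) (PM Pm Q tau tau1 e1 e2 g0 g1 g2 c0 c1 c2 c3 : rat) :
  prime p -> (2 < p)%N -> ~~ (p%:Z %| t)%Z ->
  in_Zloc p Pm -> in_Zloc p Q -> Pm != 0 -> PM != 0 -> PM = Pm * Q ->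
  in_Zloc p tau1 -> in_Zloc p e1 -> in_Zloc p e2 ->
  in_Zloc p g0 -> in_Zloc p g1 -> in_Zloc p g2 ->
  let T : rat := t%:~R in
  let d1 := PM ^+ 2 * e1 in let d2 := Pm ^+ 2 * e2 in
  tau = PM * tau1 -> tau = p%:R * g0 -> d1 = p%:R * g1 -> d2 = p%:R * g2 ->
  let sigma := tau * (2 * T + tau) in
  let al1 := c0 + T * c1 + c2 * ((sigma - d2) / Pm)
             + c3 * ((2 * T * sigma + tau * (sigma - d2)) / PM) in
  let be1 := c1 + 2 * T * c2 / Pm
             + c3 * ((4 * T ^+ 2 + sigma - d2 + 2 * T * tau) / PM) in
  let al2 := c0 - T * c1 + c2 * ((sigma - d1) / Pm)
             + c3 * ((tau * (sigma - d1) - 2 * T * d1) / PM) in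
  let be2 := c1 - 2 * T * c2 / Pm + c3 * ((tau ^+ 2 - d1) / PM) in
  in_Zloc p al1 -> in_Zloc p al2 -> in_Zloc p (PM * be1) -> in_Zloc p (Pm * be2) ->
  [/\ in_Zloc p c0, in_Zloc p c1, in_Zloc p c2 & in_Zloc p c3].
Proof.
move=> p_pr p_gt2 pt zPm zQ Pm0 PM0 PME ztau1 ze1 ze2 zg0 zg1 zg2 T d1 d2.
move=> tauE tauE' d1E d2E sigma al1 be1 al2 be2 zal1 zal2 zB1 zB2.
have p2t k n : ~~ (p%:Z %| 2 ^+ k * t ^+ n)%Z.
  by rewrite Euclid_dvdzM // negb_or p_ndvd2X // Euclid_dvdzX.
have zT : in_Zloc p T by apply: Zloc_int.
have [T2 zT2] : 2 * T != 0 /\ in_Zloc p (2 * T)^-1.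
  have -> : 2 * T = (2 ^+ 1 * t ^+ 1)%:~R by rewrite rmorphM /= !expr1.
  by split; [rewrite intr_eq0 (dvdz_nz (p2t 1%N 1%N))|apply: Zloc_inv].
have T0 : T != 0 by apply: contraNneq T2 => ->; rewrite mulr0.
have zPM : in_Zloc p PM by rewrite PME; zloc p_pr.
have zd1 : in_Zloc p d1 by rewrite /d1; zloc p_pr.
have zd2 : in_Zloc p d2 by rewrite /d2; zloc p_pr.
have ztau : in_Zloc p tau by rewrite tauE; zloc p_pr.
pose kappa := 4 * T ^+ 2 + sigma - d2 + 2 * T * tau.
have zkappa : in_Zloc p kappa by rewrite /kappa /sigma; zloc p_pr.
pose lambda := tau ^+ 2 - d1.
pose A := (al1 - al2) * (2 * T)^-1.
pose omega := (PM * Q * e1 - Pm * e2) * (2 * T)^-1.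
pose mu := (2 * T * tau1 * (2 * T + tau) + tau1 * (d1 - d2) + 2 * T * PM * e1) * (2 * T)^-1.
have zA : in_Zloc p A by rewrite /A; zloc p_pr.
have zomega : in_Zloc p omega by rewrite /omega; zloc p_pr.
have zmu : in_Zloc p mu by rewrite /mu; zloc p_pr.
have Q0 : Q != 0 by apply: contraNneq PM0 => Q0; rewrite PME Q0 mulr0.
have c1E : c1 = A - omega * c2 - mu * c3.
  rewrite /A /omega /mu /al1 /al2 /sigma /d1 /d2 tauE PME; field.
  by rewrite Pm0 Q0 T0.
pose nu := PM * (tau1 ^+ 2 - e1) - mu.
have znu : in_Zloc p nu by rewrite /nu; zloc p_pr.
pose X := Pm * be2 - Pm * A; pose Y := PM * be1 - PM * A.
have zX : in_Zloc p X by rewrite /X; zloc p_pr.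
have zY : in_Zloc p Y by rewrite /Y; zloc p_pr.
pose m11 := - (2 * T) - Pm * omega; pose m12 := Pm * nu.
pose m21 := 2 * T * Q - PM * omega; pose m22 := kappa - PM * mu.
have zm11 : in_Zloc p m11 by rewrite /m11; zloc p_pr.
have zm12 : in_Zloc p m12 by rewrite /m12; zloc p_pr.
have zm21 : in_Zloc p m21 by rewrite /m21; zloc p_pr.
have zm22 : in_Zloc p m22 by rewrite /m22; zloc p_pr.
have XE : X = m11 * c2 + m12 * c3.
  rewrite /X /be2 c1E /m11 /m12 /nu /d1 tauE PME.
  by field; rewrite Pm0 Q0.
have YE : Y = m21 * c2 + m22 * c3.
  rewrite /Y /be1 c1E /m21 /m22 /kappa PME.
  by field; rewrite Pm0 Q0.
(* Pm omega, PM mu and lambda are divisible by p even for M = m = 0. *)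
pose x1 := (g1 - g2) * (2 * T)^-1.
pose x3 := g0 * (2 * T + tau) + g0 * (d1 - d2) * (2 * T)^-1 + g1.
pose l := g0 * tau - g1.
have zx1 : in_Zloc p x1 by rewrite /x1; zloc p_pr.
have zx3 : in_Zloc p x3 by rewrite /x3; zloc p_pr.
have zl : in_Zloc p l by rewrite /l; zloc p_pr.
have x1E : Pm * omega = p%:R * x1.
  transitivity ((d1 - d2) * (2 * T)^-1); last by rewrite d1E d2E /x1; ring.
  by rewrite /omega /d1 /d2 PME; ring.
have x3E : PM * mu = p%:R * x3.
  transitivity ((2 * T * tau * (2 * T + tau) + tau * (d1 - d2) + 2 * T * d1) * (2 * T)^-1).
    by rewrite /mu tauE /d1; ring.
  transitivity (p%:R * g0 * (2 * T + tau) + p%:R * g0 * (d1 - d2) * (2 * T)^-1 + p%:R * g1).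
    by rewrite -tauE' -d1E; field.
  by rewrite /x3; ring.
have lE : lambda = p%:R * l.
  by rewrite /lambda /l mulrBr -d1E mulrA -tauE' expr2.
pose y := 4 * T * x3 - x1 * kappa - 2 * T * l + p%:R * x1 * l
  - 2 * T * (g0 * (2 * T + tau) - g2 + 2 * T * g0).
have zy : in_Zloc p y by rewrite /y; zloc p_pr.
have kappaE : kappa = 4 * T ^+ 2 + p%:R * (g0 * (2 * T + tau) - g2 + 2 * T * g0).
  transitivity (4 * T ^+ 2 + (p%:R * g0 * (2 * T + tau) - p%:R * g2 + 2 * T * (p%:R * g0))).
    by rewrite -tauE' -d2E /kappa /sigma; ring.
  by ring.
have detE : m11 * m22 - m12 * m21 = (- 2 ^+ 3 * t ^+ 3)%:~R + p%:R * y.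
  transitivity (- (2 * T) * kappa + 4 * T * (PM * mu) - (Pm * omega) * kappa
      - 2 * T * lambda + (Pm * omega) * lambda).
    by rewrite /m11 /m12 /m21 /m22 /nu /lambda /d1 tauE PME; ring.
  rewrite x1E x3E lE /y rmorphM rmorphN !rmorphXn /= -/T.
  rewrite [X in - (2 * T) * X]kappaE; ring.
have [det0 zdet] : m11 * m22 - m12 * m21 != 0 /\ in_Zloc p (m11 * m22 - m12 * m21)^-1.
  rewrite detE; apply: Zloc_1p_inv => //.
  by rewrite mulNr rpredN.
have zc2 : in_Zloc p c2.
  have -> : c2 = (X * m22 - Y * m12) * (m11 * m22 - m12 * m21)^-1.
    by rewrite XE YE; field.
  by zloc p_pr.
have zc3 : in_Zloc p c3.
  have -> : c3 = (m11 * Y - m21 * X) * (m11 * m22 - m12 * m21)^-1.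
    by rewrite XE YE; field.
  by zloc p_pr.
have zc1 : in_Zloc p c1 by rewrite c1E; zloc p_pr.
split=> //.
have -> : c0 = al1 - T * c1 - c2 * (Q * tau1 * (2 * T + tau) - Pm * e2)
    - c3 * (2 * T * tau1 * (2 * T + tau) + tau1 * (sigma - d2)).
  rewrite /al1 /d2 /sigma tauE PME; field.
  by rewrite Pm0 Q0.
by rewrite /sigma; zloc p_pr.
Qed.

(** * Integrality at the roots of an approximate factor *)

(** Reduction modulo (x - t)^2 - d1 of the element with coordinates c0, ..., c3, where
    a and b are those of the product of the two factors. *)
Lemma residue_first_factor (F : fieldType) (phi : {rmorphism rat -> F})
    (T tau d1 d2 Pm PM c0 c1 c2 c3 : rat) (x y : F) :
  Pm != 0 -> PM != 0 -> y ^+ 2 = phi d1 -> x = phi T + y ->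
  let s := T + tau in let a := - (2 * T ^+ 2 + d1 + d2) in let b := 2 * T * (d2 - d1) in
  let sigma := tau * (2 * T + tau) in
  phi c0 + phi c1 * x + phi c2 / phi Pm * (x ^+ 2 + (phi s ^+ 2 + phi a))
    + phi c3 / phi PM * ((x + phi s) * (x ^+ 2 + (phi s ^+ 2 + phi a)) + phi b) =
  phi (c0 + T * c1 + c2 * ((sigma - d2) / Pm)
     + c3 * ((2 * T * sigma + tau * (sigma - d2)) / PM))
  + phi (c1 + 2 * T * c2 / Pm
     + c3 * ((4 * T ^+ 2 + sigma - d2 + 2 * T * tau) / PM)) * y.
Proof.
rewrite -(fmorph_eq0 phi) => Pm0; rewrite -(fmorph_eq0 phi) => PM0.
by move=> y2 -> s a b sigma; rewrite /s /a /b /sigma; field: y2; rewrite Pm0 PM0.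
Qed.

Lemma residue_second_factor (F : fieldType) (phi : {rmorphism rat -> F})
    (T tau d1 d2 Pm PM c0 c1 c2 c3 : rat) (x y : F) :
  Pm != 0 -> PM != 0 -> y ^+ 2 = phi d2 -> x = - phi T + y ->
  let s := T + tau in let a := - (2 * T ^+ 2 + d1 + d2) in let b := 2 * T * (d2 - d1) in
  let sigma := tau * (2 * T + tau) in
  phi c0 + phi c1 * x + phi c2 / phi Pm * (x ^+ 2 + (phi s ^+ 2 + phi a))
    + phi c3 / phi PM * ((x + phi s) * (x ^+ 2 + (phi s ^+ 2 + phi a)) + phi b) =
  phi (c0 - T * c1 + c2 * ((sigma - d1) / Pm)
     + c3 * ((tau * (sigma - d1) - 2 * T * d1) / PM))
  + phi (c1 - 2 * T * c2 / Pm + c3 * ((tau ^+ 2 - d1) / PM)) * y.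
Proof.
rewrite -(fmorph_eq0 phi) => Pm0; rewrite -(fmorph_eq0 phi) => PM0.
by move=> y2 -> s a b sigma; rewrite /s /a /b /sigma; field: y2; rewrite Pm0 PM0.
Qed.

Section LocalIntegrality.
Variables (p : nat) (a b c t : int) (N : nat).
Hypotheses (p_pr : prime p) (p_gt2 : (2 < p)%N) (pt : ~~ (p%:Z %| t)%Z).
Hypothesis pH : (p%:Z ^+ N %| resolvent a b c t)%Z.
Variables (P : {poly int}) (h : {poly rat}) (g : {poly int}) (A : int).
Hypotheses (mP : P \is monic) (sP : (1 < size P)%N).
Hypotheses (A0 : A != 0) (AN : (logn p `|A|%N <= N)%N).
Hypothesis Phg : map_poly intr P \Po h =
  map_poly intr (quartic a b c) * (A%:~R^-1 *: map_poly intr g).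

Let p2 k n : ~~ (p%:Z %| 2 ^+ k * t ^+ n)%Z.
Proof. by rewrite Euclid_dvdzM // negb_or p_ndvd2X // Euclid_dvdzX. Qed.

(** The value f(x) is the resolvent over 16 t^2, divisible enough by p to kill the
    denominator of g; so P(h(x)) = f(x) g(x) is integral at p, and P is monic. *)
Lemma integral_at_near_root (x : algC) :
  4 * t%:~R * (x - t%:~R) ^+ 2 = (local_disc a b t)%:~R ->
  integral_at p (map_poly ratr h).[x].
Proof.
move=> xE.
have ix : integral_at p x.
  apply: (@integral_at_cancel _ p_pr _ _ (2 ^+ 2 * t ^+ 1)) => //.
  have -> : (2 ^+ 2 * t ^+ 1)%:~R * x = (4 * t * t)%:~R + 4 * t%:~R * (x - t%:~R) :> algC.
    by rewrite !rmorphM /=; ring.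
  apply: integral_atD (integral_at_int _ _ _) _ => //.
  apply: integral_at_integral => //.
  pose D : int := 4 * t * local_disc a b t.
  apply: (@integral_root_monic _ _ _ _ ('X^2 - D%:~R%:P)).
  - by rewrite monicXnsubC.
  - rewrite /root !hornerE subr_eq0; apply/eqP.
    rewrite /D !rmorphM /= -xE; ring.
  apply/integral_poly => i; rewrite coefB coefXn coefC.
  apply: integral_sub; first exact: integral_nat.
  by case: ifP => _; [apply: integral_int|apply: integral0].
apply: (integral_at_root mP sP).
have -> : (map_poly intr P).[(map_poly ratr h).[x]] =
    (map_poly intr (quartic a b c)).[x] * (A%:~R^-1 * (map_poly intr g).[x]) :> algC.
  have intrE (Q : {poly int}) :
      map_poly intr Q = map_poly (ratr : rat -> algC) (map_poly intr Q).
    by rewrite -map_poly_comp; apply: eq_map_poly => i /=; rewrite ratr_int.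
  rewrite !intrE -horner_comp -map_comp_poly Phg rmorphM /= hornerM; congr (_ * _).
  by rewrite map_polyZ hornerZ fmorphV /= ratr_int.
have fxE : 16 * t%:~R ^+ 2 * (map_poly intr (quartic a b c)).[x] =
    (resolvent a b c t)%:~R :> algC.
  have -> : (map_poly intr (quartic a b c)).[x] =
      x ^+ 4 + a%:~R * x ^+ 2 + b%:~R * x + c%:~R :> algC.
    rewrite /quartic !rmorphD /= !map_polyZ /= !map_polyXn map_polyX map_polyC /=.
    by rewrite !hornerE /=; ring.
  transitivity ((4 * t%:~R * (x - t%:~R) ^+ 2 - (local_disc a b t)%:~R) *
     (4 * t%:~R * (x + t%:~R) ^+ 2 + (local_disc a b (- t))%:~R)
     + (resolvent a b c t)%:~R : algC); last by rewrite xE subrr mul0r add0r.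
  rewrite /local_disc /resolvent.
  rewrite !(rmorphD, rmorphB, rmorphN, rmorphM, rmorphXn) /=; ring.
have [n' pn' AE] : exists2 n', ~~ (p%:Z %| n')%Z & A = n' * p%:Z ^+ logn p `|A|%N.
  have /dvdzP[n' AE] : (p%:Z ^+ logn p `|A|%N %| A)%Z by rewrite dvdz_logn.
  exists n' => //; apply/negP => pn'.
  have : (p%:Z ^+ (logn p `|A|%N).+1 %| A)%Z by rewrite [X in (_ %| X)%Z]AE exprS; apply: dvdz_mul.
  by rewrite dvdz_logn // ltnn.
have jN := AN; set j := logn p _ in jN AE.
have /dvdzP[H' HE] := dvdz_dvdXn jN pH.
have u : ~~ (p%:Z %| n' * (2 ^+ 4 * t ^+ 2))%Z by rewrite Euclid_dvdzM // negb_or pn' p2.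
apply: (integral_at_cancel p_pr u).
have n'0 : n'%:~R != 0 :> algC by rewrite intr_eq0 (dvdz_nz pn').
have pj0 : (p%:Z ^+ j)%:~R != 0 :> algC.
  by rewrite intr_eq0 expf_neq0 // eqz_nat -lt0n prime_gt0.
have -> : (n' * (2 ^+ 4 * t ^+ 2))%:~R * ((map_poly intr (quartic a b c)).[x] *
    (A%:~R^-1 * (map_poly intr g).[x])) = H'%:~R * (map_poly intr g).[x] :> algC.
  transitivity (n'%:~R * (16 * t%:~R ^+ 2 * (map_poly intr (quartic a b c)).[x]) *
    (A%:~R^-1 * (map_poly intr g).[x]) : algC).
    by rewrite !rmorphM /=; ring.
  by rewrite fxE HE AE !rmorphM /=; field; rewrite n'0 pj0.
by apply: integral_atM => //; [apply: integral_at_int|apply: integral_at_horner].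
Qed.

(** Besides al + be y, its conjugate al - be y is integral at p; hence so are al and
    be y, and be^2 D is in Z_(p). Since p^(2M+2) does not divide D, this bounds the
    denominator of be by p^M. *)
Lemma coords_near_root (M : nat) (al be : rat) :
  (p%:Z ^+ M.*2 %| local_disc a b t)%Z -> ~~ (p%:Z ^+ M.*2.+2 %| local_disc a b t)%Z ->
  (forall x y : algC, y ^+ 2 = (local_disc a b t)%:~R / (4 * t%:~R) -> x = t%:~R + y ->
     (map_poly ratr h).[x] = ratr al + ratr be * y) ->
  in_Zloc p al /\ in_Zloc p (p%:R ^+ M * be).
Proof.
move=> pD pD' hE; set D := local_disc a b t in pD pD' hE.
have t0 : t%:~R != 0 :> algC by rewrite intr_eq0 (dvdz_nz pt).
have t0' : t%:~R != 0 :> rat by rewrite intr_eq0 (dvdz_nz pt).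
have [y y2] : exists y : algC, y ^+ 2 = D%:~R / (4 * t%:~R).
  by exists (sqrtC (D%:~R / (4 * t%:~R))); rewrite sqrtCK.
have Ny2 : (- y) ^+ 2 = D%:~R / (4 * t%:~R) by rewrite sqrrN.
have i1 : integral_at p (ratr al + ratr be * y).
  rewrite -(hE _ _ y2 erefl); apply: integral_at_near_root.
  by rewrite addrC addKr y2 mulrC divfK // mulf_neq0 // pnatr_eq0.
have i2 : integral_at p (ratr al - ratr be * y).
  rewrite -mulrN -(hE _ _ Ny2 erefl); apply: integral_at_near_root.
  by rewrite addrC addKr Ny2 mulrC divfK // mulf_neq0 // pnatr_eq0.
have pn2 : ~~ (p%:Z %| 2)%Z by exact: (p_ndvd2X p_pr p_gt2 1).
have ial : integral_at p (ratr al : algC).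
  apply: (integral_at_cancel p_pr pn2).
  have -> : 2%:~R * ratr al = (ratr al + ratr be * y) + (ratr al - ratr be * y) by ring.
  exact: integral_atD.
have ibe : integral_at p (ratr be * y).
  have -> : ratr be * y = ratr al + ratr be * y + (-1)%:~R * ratr al by ring.
  by apply: integral_atD => //; apply: integral_atM => //; apply: integral_at_int.
split; first exact: integral_at_rat.
have iD : in_Zloc p (be ^+ 2 * D%:~R).
  apply: (integral_at_rat p_pr).
  have -> : ratr (be ^+ 2 * D%:~R) = (4 * t)%:~R * ((ratr be * y) * (ratr be * y)) :> algC.
    transitivity ((4 * t)%:~R * (ratr be ^+ 2 * y ^+ 2)); last by ring.
    rewrite y2 rmorphM rmorphXn /= ratr_int rmorphM /=; field.
    by rewrite t0.
  by apply: integral_atM => //; [apply: integral_at_int|apply: integral_atM].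
have /dvdzP[D' DE] := pD.
apply: (@Zloc_sqr _ p_pr _ D').
  have -> : (p%:R ^+ M * be) ^+ 2 * D'%:~R = be ^+ 2 * D%:~R :> rat.
    rewrite DE rmorphM rmorphXn /= -pmulrn -muln2 exprM; ring.
  by [].
apply: contra pD' => h'; rewrite DE -addn2 addnC exprD dvdz_mul //.
Qed.

End LocalIntegrality.

(** * Coordinates of integral elements *)

(** The fourth polynomial is (f(x) - f(s)) / (x - s), in the form
    (x + s) (x^2 + s^2 + a) + b that shows its residues modulo the two factors. *)
Definition basis_poly (a b s : int) (Pm PM c0 c1 c2 c3 : rat) : {poly rat} :=
  c0%:P + c1 *: 'X + (c2 / Pm) *: ('X^2 + (s ^+ 2 + a)%:~R%:P)
  + (c3 / PM) *: (('X + s%:~R%:P) * ('X^2 + (s ^+ 2 + a)%:~R%:P) + b%:~R%:P).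

Lemma horner_basis_poly (F : fieldType) (phi : {rmorphism rat -> F})
    (a b s : int) (Pm PM c0 c1 c2 c3 : rat) (x : F) :
  (map_poly phi (basis_poly a b s Pm PM c0 c1 c2 c3)).[x] =
  phi c0 + phi c1 * x + phi c2 / phi Pm * (x ^+ 2 + (s%:~R ^+ 2 + a%:~R))
  + phi c3 / phi PM * ((x + s%:~R) * (x ^+ 2 + (s%:~R ^+ 2 + a%:~R)) + b%:~R).
Proof.
rewrite /basis_poly !rmorphD /= !map_polyZ /= !(rmorphD, rmorphM) /= ?(map_polyC, map_polyX, map_polyXn) /=.
rewrite !hornerE /=. 
by rewrite !rmorph_int !fmorphV; ring.
Qed.

(** The approximation t is chosen after g, with precision the p-part of the
    denominator of g. *)
Lemma coords_Zloc (p : nat) (a b c s : int) (M m : nat) (c0 c1 c2 c3 : rat)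
    (P : {poly int}) (g : {poly rat}) :
  prime p -> (2 < p)%N -> (m <= M)%N ->
  (forall N, exists t, near_split p a b c s M m N t) ->
  P \is monic -> (1 < size P)%N ->
  map_poly intr P \Po basis_poly a b s (p%:R ^+ m) (p%:R ^+ M) c0 c1 c2 c3 =
    map_poly intr (quartic a b c) * g ->
  [/\ in_Zloc p c0, in_Zloc p c1, in_Zloc p c2 & in_Zloc p c3].
Proof.
move=> p_pr p_gt2 mM split mP sP; case: (rat_poly_scale g) => g' [A A0 ->] Phg.
have [t [pst pt pH pM p1 p2 d1M d1M' d2m d2m']] := split (logn p `|A|%N).
have ptN : ~~ (p%:Z %| - t)%Z by rewrite rpredN.
have HN : resolvent a b c (- t) = resolvent a b c t by rewrite /resolvent; ring.
have pHN : (p%:Z ^+ logn p `|A|%N %| resolvent a b c (- t))%Z by rewrite HN.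
set h := basis_poly _ _ _ _ _ _ _ _ _ in Phg.
set D1 := local_disc a b t in p1 d1M d1M'.
set D2 := local_disc a b (- t) in p2 d2m d2m'.
have p0 : p%:R != 0 :> rat by rewrite pnatr_eq0 -lt0n prime_gt0.
pose PM : rat := p%:R ^+ M; pose Pm : rat := p%:R ^+ m.
have PM0 : PM != 0 by rewrite expf_neq0.
have Pm0 : Pm != 0 by rewrite expf_neq0.
have rPM0 : ratr PM != 0 :> algC by rewrite fmorph_eq0.
have rPm0 : ratr Pm != 0 :> algC by rewrite fmorph_eq0.
pose T : rat := t%:~R; pose tau : rat := (s - t)%:~R.
have T0 : T != 0 by rewrite intr_eq0 (dvdz_nz pt).
have rT0 : t%:~R != 0 :> algC by rewrite intr_eq0 (dvdz_nz pt).
pose d1 := D1%:~R / (4 * T); pose d2 := D2%:~R / (4 * - T).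
pose sigma := tau * (2 * T + tau).
have sE : s%:~R = T + tau by rewrite /T /tau rmorphB /=; ring.
have aE : a%:~R = - (2 * T ^+ 2 + d1 + d2).
  rewrite /d1 /d2 /D1 /D2 /local_disc !(rmorphN, rmorphD, rmorphM, rmorphXn) /= -/T.
  by field.
have bE : b%:~R = 2 * T * (d2 - d1).
  rewrite /d1 /d2 /D1 /D2 /local_disc !(rmorphN, rmorphD, rmorphM, rmorphXn) /= -/T.
  by field.
pose al1 := c0 + T * c1 + c2 * ((sigma - d2) / Pm)
  + c3 * ((2 * T * sigma + tau * (sigma - d2)) / PM).
pose be1 := c1 + 2 * T * c2 / Pm
  + c3 * ((4 * T ^+ 2 + sigma - d2 + 2 * T * tau) / PM).
pose al2 := c0 - T * c1 + c2 * ((sigma - d1) / Pm)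
  + c3 * ((tau * (sigma - d1) - 2 * T * d1) / PM).
pose be2 := c1 - 2 * T * c2 / Pm + c3 * ((tau ^+ 2 - d1) / PM).
have toC (z : int) : z%:~R = ratr z%:~R :> algC by rewrite ratr_int.
have h1 (x y : algC) : y ^+ 2 = D1%:~R / (4 * t%:~R) -> x = t%:~R + y ->
    (map_poly ratr h).[x] = ratr al1 + ratr be1 * y.
  move=> y2 xE; rewrite horner_basis_poly !toC sE aE bE.
  apply: residue_first_factor => //=; last by rewrite xE /T ratr_int.
  by rewrite y2 /d1 /T fmorph_div rmorphM /= !ratr_int rmorph_nat.
have h2 (x y : algC) : y ^+ 2 = D2%:~R / (4 * (- t)%:~R) -> x = (- t)%:~R + y ->
    (map_poly ratr h).[x] = ratr al2 + ratr be2 * y.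
  move=> y2 xE; rewrite horner_basis_poly !toC sE aE bE.
  apply: residue_second_factor => //=; last by rewrite xE /T rmorphN /= ratr_int.
  by rewrite y2 /d2 /T fmorph_div rmorphM !rmorphN /= !ratr_int rmorph_nat.
have [zal1 zB1] := coords_near_root p_pr p_gt2 pt pH mP sP A0 (leqnn _) Phg d1M d1M' h1.
have [zal2 zB2] := coords_near_root p_pr p_gt2 ptN pHN mP sP A0 (leqnn _) Phg d2m d2m' h2.
have zinv (n : int) : ~~ (p%:Z %| n)%Z -> in_Zloc p (4 * n%:~R)^-1.
  move=> pn; have -> : 4 * n%:~R = (2 ^+ 2 * n)%:~R :> rat by rewrite rmorphM.
  by apply: Zloc_inv; rewrite Euclid_dvdzM // negb_or p_ndvd2X.
have TN : - T = (- t)%:~R by rewrite rmorphN.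
have [w1 w1E] := dvdzP d1M; have [w2 w2E] := dvdzP d2m.
have [v1 v1E] := dvdzP p1; have [v2 v2E] := dvdzP p2.
have [q0 q0E] := dvdzP pst; have [q1 q1E] := dvdzP pM.
have zq : in_Zloc p (p%:R ^+ (M - m)) by apply: ZlocX => //; apply: Zloc_nat.
have zPm : in_Zloc p Pm by apply: ZlocX => //; apply: Zloc_nat.
have PME : PM = Pm * p%:R ^+ (M - m) by rewrite -exprD subnKC.
have tauE : tau = PM * q1%:~R.
  by rewrite /tau q1E rmorphM rmorphXn /= -pmulrn mulrC.
have tauE' : tau = p%:R * q0%:~R by rewrite /tau q0E rmorphM /= -pmulrn mulrC.
have d1E : d1 = PM ^+ 2 * (w1%:~R / (4 * T)).
  rewrite /d1 w1E rmorphM rmorphXn /= -pmulrn -exprM muln2; ring.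
have d2E : d2 = Pm ^+ 2 * (w2%:~R / (4 * - T)).
  rewrite /d2 w2E rmorphM rmorphXn /= -pmulrn -exprM muln2; ring.
have d1E' : d1 = p%:R * (v1%:~R / (4 * T)) by rewrite /d1 v1E rmorphM /= -pmulrn; ring.
have d2E' : d2 = p%:R * (v2%:~R / (4 * - T)) by rewrite /d2 v2E rmorphM /= -pmulrn; ring.
have zT n : in_Zloc p (n%:~R / (4 * T)).
  by apply: ZlocM => //; [apply: Zloc_int|apply: zinv].
have zTN n : in_Zloc p (n%:~R / (4 * - T)).
  by apply: ZlocM => //; [apply: Zloc_int|rewrite TN; apply: zinv].
apply: (Zloc_coords p_pr p_gt2 pt zPm zq Pm0 PM0 PME (Zloc_int p_pr q1) (zT w1)
  (zTN w2) (Zloc_int p_pr q0) (zT v1) (zTN v2) tauE tauE').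
- by rewrite -d1E.
- by rewrite -d2E.
- by rewrite -d2E.
- by rewrite -d1E.
- by rewrite -d2E.
by rewrite -d1E.
Qed.

(** * Two double roots modulo p *)

Section SplitQuartic.
Variable F : fieldType.
Hypothesis two_neq0 : 2 != 0 :> F.
Implicit Types A B C u v : F.

Lemma two_squares_expand u v :
  ('X - u%:P) ^+ 2 * ('X - v%:P) ^+ 2 =
  Poly [:: u ^+ 2 * v ^+ 2; - (2 * u * v * (u + v)); u ^+ 2 + 4 * u * v + v ^+ 2;
           - (2 * (u + v)); 1].
Proof.
by rewrite /= !cons_poly_def; ring.
Qed.

Lemma two_squares_quartic A B C u v :
  'X^4 + A *: 'X^2 + B *: 'X + C%:P = ('X - u%:P) ^+ 2 * ('X - v%:P) ^+ 2 ->
  [/\ v = - u, A = - (2 * u ^+ 2), B = 0 & C = u ^+ 4].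
Proof.
rewrite two_squares_expand quartic_polyseq => /polyP E.
have /eqP := E 3%N; rewrite !coef_Poly /= eq_sym oppr_eq0 mulf_eq0 (negPf two_neq0) /=.
rewrite addrC addr_eq0 => /eqP vE.
have := E 2%N; have := E 1%N; have := E 0%N; rewrite !coef_Poly /= vE => -> -> ->.
by split=> //; ring.
Qed.

(** A quartic without cubic term that has double roots u and v is the product of
    (X - u)^2 and (X - v)^2, and the cubic coefficient gives v = - u. *)
Lemma quartic_two_double_roots A B C :
  (exists u v, [/\ u != v, mup u ('X^4 + A *: 'X^2 + B *: 'X + C%:P) = 2%N
     & mup v ('X^4 + A *: 'X^2 + B *: 'X + C%:P) = 2%N]) <->
  [/\ A != 0, B = 0, C != 0, A ^+ 2 = 4 * C & exists t, - A / 2 = t ^+ 2].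
Proof.
set G := _ + C%:P; have sG : size G = 5 := size_quartic A B C.
have G0 : G != 0 by rewrite -size_poly_eq0 sG.
have mG : G \is monic.
  by rewrite monicE lead_coefE sG /G quartic_polyseq coef_Poly.
split=> [[u [v [uv mu mv]]]|[A0 B0 C0 AC [t tE]]].
  have du : ('X - u%:P) ^+ 2 %| G by rewrite -mup_geq // mu.
  have dv : ('X - v%:P) ^+ 2 %| G by rewrite -mup_geq // mv.
  have cop : coprimep (('X - u%:P) ^+ 2) (('X - v%:P) ^+ 2).
    by rewrite coprimep_expl // coprimep_expr // coprimep_XsubC root_XsubC eq_sym.
  have dG : ('X - u%:P) ^+ 2 * ('X - v%:P) ^+ 2 %| G by rewrite Gauss_dvdp // du.
  have mQ : ('X - u%:P) ^+ 2 * ('X - v%:P) ^+ 2 \is monic.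
    by rewrite monicMl ?monic_exp ?monicXsubC.
  have sQ : size (('X - u%:P) ^+ 2 * ('X - v%:P) ^+ 2) = 5.
    by rewrite size_monicM ?monic_exp ?monicXsubC ?monic_neq0 ?monic_exp ?monicXsubC //
      !size_exp_XsubC.
  have /eqP GE : G == ('X - u%:P) ^+ 2 * ('X - v%:P) ^+ 2.
    by rewrite eq_sym -eqp_monic // -dvdp_size_eqp // sQ sG.
  have [vE -> -> ->] := two_squares_quartic GE.
  have u0 : u != 0 by apply: contraNneq uv => u0; rewrite vE u0 oppr0.
  split=> //.
  - by rewrite oppr_eq0 mulf_neq0 // expf_neq0.
  - by rewrite expf_neq0.
  - by ring.
  by exists u; field.
have t0 : t != 0.
  apply: contraNneq A0 => t0; move/eqP: tE.
  by rewrite t0 expr0n /= mulf_eq0 oppr_eq0 invr_eq0 (negPf two_neq0) orbF.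
have AE : A = - (2 * t ^+ 2) by rewrite -tE; field.
have CE : C = t ^+ 4.
  apply: (mulfI (mulf_neq0 two_neq0 two_neq0)).
  have -> : 2 * 2 * C = A ^+ 2 by rewrite AC; ring.
  by rewrite AE; ring.
have tNt : t != - t.
  by rewrite -subr_eq0 opprK -mulr2n -mulr_natl mulf_neq0.
have GE : G = ('X - t%:P) ^+ 2 * ('X - (- t)%:P) ^+ 2.
  rewrite two_squares_expand /G quartic_polyseq; congr Poly.
  by rewrite subrr !mulr0 oppr0 AE B0 CE; congr [:: _, _, _ & _]; ring.
have nroot u v : u != v -> ~~ root (('X - v%:P) ^+ 2) u.
  by move=> uv; rewrite rootE horner_exp hornerXsubC expf_eq0 subr_eq0.
exists t, (- t); split=> //; rewrite GE.
  by rewrite mupMl ?nroot // mup_XsubCX eqxx.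
by rewrite mupMr ?nroot 1?eq_sym // mup_XsubCX eqxx.
Qed.

End SplitQuartic.

Lemma red_quartic p (a b c : int) :
  red_poly p (quartic a b c) =
  'X^4 + a%:~R *: 'X^2 + b%:~R *: 'X + (c%:~R)%:P :> {poly 'F_p}.
Proof.
by rewrite /red_poly /quartic !rmorphD /= !map_polyZ /= !map_polyXn map_polyX map_polyC.
Qed.

Lemma Fp_two_neq0 p : prime p -> (2 < p)%N -> 2 != 0 :> 'F_p.
Proof.
move=> p_pr p_gt2; have := p_ndvd2X p_pr p_gt2 1.
by rewrite -Fp_intr_eq0.
Qed.

Lemma two_double_roots_quartic p (a b c : int) : prime p -> (2 < p)%N ->
  two_double_roots_mod p (quartic a b c) <->
  [/\ ~~ (p%:Z %| a)%Z, (p%:Z %| b)%Z, ~~ (p%:Z %| c)%Z,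
      (a ^+ 2 = 4 * c %[mod p%:Z])%Z
    & exists t : 'F_p, - a%:~R / 2 = t ^+ 2].
Proof.
move=> p_pr p_gt2; rewrite /two_double_roots_mod red_quartic.
rewrite (quartic_two_double_roots (Fp_two_neq0 p_pr p_gt2)).
rewrite -!Fp_intr_eq0 //.
have modE : (a ^+ 2 = 4 * c %[mod p%:Z])%Z <-> a%:~R ^+ 2 = 4 * c%:~R :> 'F_p.
  have castE : (a ^+ 2 - 4 * c)%:~R = a%:~R ^+ 2 - 4 * c%:~R :> 'F_p.
    by rewrite rmorphB !rmorphM /= -expr2.
  split=> [/eqP|h]; last apply/eqP; rewrite eqz_mod_dvd -Fp_intr_eq0 // castE.
    by rewrite subr_eq0 => /eqP.
  by rewrite h subrr.
by split=> -[h1 /eqP h2 h3 /modE h4 h5]; split=> //; apply/eqP.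
Qed.

Lemma double_roots_red p (a b c s : int) : prime p -> (2 < p)%N ->
  ~~ (p%:Z %| c)%Z ->
  red_poly p (quartic a b c) =
    ('X - (s%:~R)%:P) ^+ 2 * ('X + (s%:~R)%:P) ^+ 2 ->
  double_roots p a b c s.
Proof.
move=> p_pr p_gt2 pc; rewrite red_quartic.
have -> : 'X + (s%:~R)%:P = 'X - (- s%:~R)%:P :> {poly 'F_p} by rewrite polyCN opprK.
case/(two_squares_quartic (Fp_two_neq0 p_pr p_gt2)) => _ aE bE cE.
have s0 : s%:~R != 0 :> 'F_p.
  apply: contraNneq pc => s0; rewrite -Fp_intr_eq0 // cE s0.
  by rewrite expr0n.
split; rewrite -Fp_intr_eq0 //.
- by rewrite rmorphD rmorphM rmorphXn /= aE addNr.
- by rewrite bE.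
by rewrite rmorphB rmorphXn /= cE subrr.
Qed.

(** * Integrality of the basis *)

Lemma integral_monic_eq (E : fieldType) (n : nat) (u : nat -> E) (w : E) :
  (forall i, integralOver (intr : int -> E) (u i)) ->
  w ^+ n = \sum_(i < n) u i * w ^+ i -> integralOver (intr : int -> E) w.
Proof.
move=> iu wE; have sP : (size (\poly_(i < n) u i) <= n)%N by apply: size_poly.
apply: (@integral_root_monic _ _ _ _ ('X^n - \poly_(i < n) u i)).
- rewrite monicE lead_coefDl ?lead_coefXn //.
  by rewrite size_polyN size_polyXn ltnS.
- by rewrite rootE !hornerE horner_poly wE subrr.
apply/integral_poly => i; rewrite coefB coefXn coef_poly.
apply: integral_sub; first exact: integral_nat.
by case: ifP => _; [apply: iu|apply: integral0].
Qed.

Lemma irreducible_dvdp_root (L : fieldExtType rat) (f h : {poly rat}) (x : L) :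
  irreducible_poly f -> root (map_poly (in_alg L) f) x ->
  root (map_poly (in_alg L) h) x -> f %| h.
Proof.
move=> [sf irr] rf rh; have [cop|ncop] := boolP (coprimep f h).
  by have := coprimep_root (etrans (coprimep_map _ _ _) cop) rf; rewrite (eqP rh) eqxx.
have /eqp_dvdl <- : gcdp f h %= f by apply: irr; rewrite ?dvdp_gcdl.
exact: dvdp_gcdr.
Qed.

Lemma basis_polyE (a b s : int) (Pm PM c0 c1 c2 c3 : rat) :
  basis_poly a b s Pm PM c0 c1 c2 c3 =
  Poly [:: c0 + c2 / Pm * (s%:~R ^+ 2 + a%:~R)
             + c3 / PM * (s%:~R * (s%:~R ^+ 2 + a%:~R) + b%:~R);
           c1 + c3 / PM * (s%:~R ^+ 2 + a%:~R);
           c2 / Pm + c3 / PM * s%:~R; c3 / PM].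
Proof.
rewrite /basis_poly -!mul_polyC rmorphD rmorphXn /= !cons_poly_def; ring.
Qed.

Section NumberField.
Variables (p : nat) (a b c s : int) (M m : nat) (L : fieldExtType rat) (theta : L).
Hypotheses (p_pr : prime p) (p_gt2 : (2 < p)%N) (mM : (m <= M)%N).
Let f := quartic a b c.
Hypothesis f_irr : irreducible_poly (map_poly intr f : {poly rat}).
Hypothesis theta_root : root (map_poly intr f) theta.
Hypothesis dr : double_roots p a b c s.
Hypotheses (iM : index_at p a b c s M) (im : index_at p a b c (- s) m).

Let w2 : L := (theta ^+ 2 + (s ^+ 2 + a)%:~R) / p%:R ^+ m.
Let w3 : L := (theta ^+ 3 + s%:~R * theta ^+ 2 + (a + s ^+ 2)%:~R * theta
                 + (s ^+ 3 + a * s + b)%:~R) / p%:R ^+ M.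

Let p_neq0 : p%:R != 0 :> L.
Proof.
have := fmorph_eq0 (in_alg L : {rmorphism rat -> L}) p%:R; rewrite rmorph_nat => ->.
by rewrite pnatr_eq0 -lt0n prime_gt0.
Qed.

Let theta_eq : theta ^+ 4 + a%:~R * theta ^+ 2 + b%:~R * theta + c%:~R = 0.
Proof.
move: theta_root; rewrite rootE /f /quartic !rmorphD /= !map_polyZ /= !map_polyXn.
by rewrite map_polyX map_polyC /= !hornerE /= => /eqP <-; ring.
Qed.

Let theta4 : theta ^+ 4 = - (a%:~R * theta ^+ 2 + b%:~R * theta + c%:~R).
Proof. by apply/eqP; rewrite -addr_eq0 !addrA theta_eq. Qed.

Lemma integral_theta : integralOver (intr : int -> L) theta.
Proof.
apply: (@integral_monic_eq _ 4 (nth 0 [:: - c%:~R; - b%:~R; - a%:~R])).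
  move=> i; case: i => [|[|[|i]]] /=; rewrite ?nth_nil; try exact: integral0;
  by apply: integral_opp; apply: integral_int.
rewrite !big_ord_recl big_ord0 /= /bump /=; ring: theta4.
Qed.

(** As m <= M, both f(s) and f(- s) are divisible by p^(2m); their sum and their
    difference give the constant term and b. *)
Lemma index_dvd : [/\ (p%:Z ^+ m.*2 %| b)%Z, (p%:Z ^+ m.*2 %| s ^+ 4 + a * s ^+ 2 + c)%Z
  & (p%:Z ^+ m %| 2 * s ^+ 2 + a)%Z].
Proof.
have [ps _ _ _] := dr; case: iM im => M0 _ _ [m0 m1 _].
move: M0 m0 m1; rewrite !horner_quartic horner_deriv_quartic => M0 m0 m1.
have {}M0 : (p%:Z ^+ m.*2 %| s ^+ 4 + a * s ^+ 2 + b * s + c)%Z.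
  by apply: dvdz_dvdXn M0; rewrite leq_double.
have p2s k : ~~ (p%:Z %| 2 * s ^+ k)%Z.
  by rewrite Euclid_dvdzM // negb_or (p_ndvd2X p_pr p_gt2 1) Euclid_dvdzX.
have pb : (p%:Z ^+ m.*2 %| b)%Z.
  rewrite -(Gauss_dvdzX p_pr _ _ (p2s 1%N)).
  have -> : 2 * s ^+ 1 * b = (s ^+ 4 + a * s ^+ 2 + b * s + c) -
    ((- s) ^+ 4 + a * (- s) ^+ 2 + b * - s + c) by ring.
  exact: rpredB.
split=> //.
  have -> : s ^+ 4 + a * s ^+ 2 + c = (s ^+ 4 + a * s ^+ 2 + b * s + c) - b * s by ring.
  by apply: rpredB => //; apply: dvdz_mulr.
rewrite -(Gauss_dvdzX p_pr _ _ (p2s 1%N)).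
have -> : 2 * s ^+ 1 * (2 * s ^+ 2 + a) = b -
  (4 * (- s) ^+ 3 + 2 * a * - s + b) by ring.
by apply: rpredB => //; apply: dvdz_dvdXn pb; rewrite -addnn leq_addr.
Qed.

(** On theta, (x^2 - s^2) (x^2 + s^2 + a) + b x + (s^4 + a s^2 + c) vanishes. This is a
    quadratic equation for x^2 + s^2 + a, and dividing it by p^(2m) leaves integral
    coefficients. *)
Lemma integral_w2 : integralOver (intr : int -> L) w2.
Proof.
have [/dvdzP[b' bE] /dvdzP[C' CE] /dvdzP[D' DE]] := index_dvd.
apply: (@integral_monic_eq _ 2 (nth 0 [:: - (b'%:~R * theta + C'%:~R); D'%:~R])).
  move=> i; case: i => [|[|i]] /=; rewrite ?nth_nil.
  - apply: integral_opp; apply: integral_add; last exact: integral_int.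
    by apply: integral_mul; [apply: integral_int|apply: integral_theta].
  - exact: integral_int.
  exact: integral0.
rewrite !big_ord_recl big_ord0 /= /bump /= addr0 expr0 mulr1 expr1.
have pm0 : p%:R ^+ m != 0 :> L by rewrite expf_neq0.
have toL (x y : int) k : x = y * p%:Z ^+ k -> x%:~R = y%:~R * p%:R ^+ k :> L.
  by move=> ->; rewrite rmorphM rmorphXn /= -pmulrn.
have {}bE := toL _ _ _ bE; have {}CE := toL _ _ _ CE; have {}DE := toL _ _ _ DE.
apply: (mulfI (expf_neq0 2 pm0)).
have -> : (p%:R ^+ m) ^+ 2 * w2 ^+ 2 = (theta ^+ 2 + (s ^+ 2 + a)%:~R) ^+ 2.
  by rewrite /w2; field.
have -> : (p%:R ^+ m) ^+ 2 * (- (b'%:~R * theta + C'%:~R) + D'%:~R * w2) =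
  - (b%:~R * theta + (s ^+ 4 + a * s ^+ 2 + c)%:~R)
  + (2 * s ^+ 2 + a)%:~R * (theta ^+ 2 + (s ^+ 2 + a)%:~R).
  by rewrite bE CE DE -muln2 exprM /w2; field.
ring: theta4.
Qed.

Lemma horner_s_neq0 : f.[s] != 0.
Proof.
apply/negP => /eqP fs0; have [sf irr] := f_irr.
have sfE : size (map_poly intr f : {poly rat}) = 5.
  by rewrite size_map_inj_poly ?size_quartic //; apply: intr_inj.
have dv : 'X - (s%:~R)%:P %| (map_poly intr f : {poly rat}).
  by rewrite dvdp_XsubCl rootE horner_map fs0.
have := irr _ _ dv; rewrite size_XsubC => /(_ isT) /eqp_size.
by rewrite size_XsubC sfE.
Qed.

(** Since w3 = - f(s) / (p^M (theta - s)), the equation of w3 is the reversed Taylor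
    expansion of f at s, rescaled. *)
Lemma integral_w3 : integralOver (intr : int -> L) w3.
Proof.
have fs0 := horner_s_neq0.
case: iM => /dvdzP[a0 a0E] /dvdzP[a1 a1E] _.
pose A2 := 6 * s ^+ 2 + a; pose A3 := 4 * s.
apply: (@integral_monic_eq _ 4 (nth 0 [:: (- (a0 ^+ 3 * p%:Z ^+ M.*2))%:~R;
  (A3 * a0 ^+ 2 * p%:Z ^+ M)%:~R; (- (A2 * a0))%:~R; a1%:~R])).
  move=> i; case: i => [|[|[|[|i]]]] /=; rewrite ?nth_nil; try exact: integral0;
  exact: integral_int.
rewrite !big_ord_recl big_ord0 /= /bump /=.
pose y := theta - s%:~R; pose q : L := p%:R ^+ M.
have q0 : q != 0 by rewrite expf_neq0.
have pq : (p%:Z ^+ M)%:~R = q :> L by rewrite rmorphXn /= -pmulrn.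
have pqq : (p%:Z ^+ M.*2)%:~R = q ^+ 2 :> L.
  by rewrite rmorphXn /= -pmulrn -muln2 exprM.
have A0E : s%:~R ^+ 4 + a%:~R * s%:~R ^+ 2 + b%:~R * s%:~R + c%:~R = a0%:~R * q ^+ 2 :> L.
  have := congr1 (intr : int -> L) a0E.
  rewrite horner_quartic [RHS]rmorphM /= pqq => <-; ring.
have A1E : 4 * s%:~R ^+ 3 + 2 * a%:~R * s%:~R + b%:~R = a1%:~R * q :> L.
  have := congr1 (intr : int -> L) a1E.
  rewrite horner_deriv_quartic [RHS]rmorphM /= pq => <-; ring.
have fE : y ^+ 4 = - (a0%:~R * q ^+ 2 + a1%:~R * q * y + A2%:~R * y ^+ 2 + A3%:~R * y ^+ 3).
  by rewrite -A0E -A1E /y /A2 /A3; ring: theta4.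
have wy : w3 * y = - (a0%:~R * q).
  apply: (mulfI q0).
  have -> : q * - (a0%:~R * q) = - (s%:~R ^+ 4 + a%:~R * s%:~R ^+ 2 + b%:~R * s%:~R + c%:~R).
    by rewrite A0E; ring.
  transitivity ((theta ^+ 4 + a%:~R * theta ^+ 2 + b%:~R * theta + c%:~R) -
    (s%:~R ^+ 4 + a%:~R * s%:~R ^+ 2 + b%:~R * s%:~R + c%:~R)).
    by rewrite /w3 -/q /y; field.
  by rewrite theta_eq sub0r.
(* The equation for w3 is checked after multiplication by y^4, through w3 y. *)
have y0 : y != 0.
  apply: contraNneq fs0 => y0; have := fE; rewrite y0 !expr0n /= !mulr0 !addr0 -pqq -rmorphM /= -a0E.
  move/eqP; rewrite eq_sym oppr_eq0 -[X in X == _](rmorph_int (in_alg L)) fmorph_eq0 intr_eq0.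
  exact: id.
apply: (mulIf (expf_neq0 4 y0)); rewrite -exprMn wy.
rewrite !(rmorphN, rmorphM) /= pq.
transitivity (- (a0%:~R ^+ 3 * q ^+ 2) * y ^+ 4 + A3%:~R * a0%:~R ^+ 2 * q * (w3 * y) * y ^+ 3
  - A2%:~R * a0%:~R * (w3 * y) ^+ 2 * y ^+ 2 + a1%:~R * (w3 * y) ^+ 3 * y).
  by rewrite wy; ring: fE.
by rewrite pqq /A3; ring.
Qed.

End NumberField.

(** * The p-integral basis *)

(** Independence holds because the basis is triangular in the powers of theta. *)
Lemma p_integral_basis_split (p : nat) (a b c s : int) (M m : nat)
    (L : fieldExtType rat) (theta : L) :
  prime p -> (2 < p)%N -> (m <= M)%N ->
  irreducible_poly (map_poly intr (quartic a b c) : {poly rat}) ->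
  root (map_poly intr (quartic a b c)) theta ->
  double_roots p a b c s ->
  regular_at p (quartic a b c) s -> regular_at p (quartic a b c) (- s) ->
  index_at p a b c s M -> index_at p a b c (- s) m ->
  p_integral_basis p <<1; theta>>%AS
    [tuple 1; theta; (theta ^+ 2 + (s ^+ 2 + a)%:~R) / p%:R ^+ m;
       (theta ^+ 3 + s%:~R * theta ^+ 2 + (a + s ^+ 2)%:~R * theta
          + (s ^+ 3 + a * s + b)%:~R) / p%:R ^+ M].
Proof.
move=> p_pr p_gt2 mM f_irr theta_root dr reg regN iM im.
set w2 := _ / p%:R ^+ m; set w3 := _ / p%:R ^+ M.
pose Pm : rat := p%:R ^+ m; pose PM : rat := p%:R ^+ M.
have p0 : p%:R != 0 :> rat by rewrite pnatr_eq0 -lt0n prime_gt0.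
have Pm0 : Pm != 0 by rewrite expf_neq0.
have PM0 : PM != 0 by rewrite expf_neq0.
pose h (c0 c1 c2 c3 : rat) := basis_poly a b s Pm PM c0 c1 c2 c3.
have sumE (e : 'I_4 -> rat) : \sum_i e i *: tnth [tuple 1; theta; w2; w3] i =
    (map_poly (in_alg L) (h (e 0) (e 1) (e 2) (e 3))).[theta].
  (* An opaque copy of the embedding keeps [in_alg] from being simplified. *)
  have [phi [phiE phiZ]] : exists phi : {rmorphism rat -> L},
      (forall q, map_poly (in_alg L) q = map_poly phi q) /\
      (forall k x, k *: x = phi k * x).
    by exists (in_alg L); split=> // k x; rewrite mulr_algl.
  have phiX k : phi (p%:R ^+ k) = p%:R ^+ k by rewrite rmorphXn rmorph_nat.
  rewrite phiE horner_basis_poly !phiX !big_ord_recl big_ord0 !(tnth_nth 0) /= !phiZ.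
  have -> : lift ord0 ord0 = 1 :> 'I_4 by apply: val_inj.
  have -> : lift ord0 (lift ord0 ord0) = 2 :> 'I_4 by apply: val_inj.
  have -> : lift ord0 (lift ord0 (lift ord0 ord0)) = 3 :> 'I_4 by apply: val_inj.
  rewrite /w2 /w3 /=; ring.
have f_intr : map_poly intr (quartic a b c) =
    map_poly (in_alg L) (map_poly intr (quartic a b c)).
  by rewrite -map_poly_comp; apply: eq_map_poly => i; apply: (esym (rmorph_int (in_alg L) i)).
have rootL : root (map_poly (in_alg L) (map_poly intr (quartic a b c))) theta.
  by rewrite -f_intr.
have sf : size (map_poly intr (quartic a b c) : {poly rat}) = 5.
  by rewrite size_map_inj_poly ?size_quartic //; apply: intr_inj.
have f0 : map_poly intr (quartic a b c) != 0 :> {poly rat} by rewrite -size_poly_eq0 sf.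
split.
- move=> i; exists (tnth [tuple 1; theta; w2; w3] i), 1; split; last by rewrite divr1.
    split; last first.
      case: i => -[|[|[|[|//]]]] ?; rewrite (tnth_nth 0) /=.
      + exact: integral1.
      + exact: (integral_theta theta_root).
      + exact: (integral_w2 p_pr p_gt2 mM theta_root dr iM im).
      + exact: (integral_w3 p_pr f_irr theta_root iM).
    have thK : theta \in <<1; theta>>%AS by exact: memv_adjoin.
    case: i => -[|[|[|[|//]]]] ?; rewrite (tnth_nth 0) /=.
    + exact: rpred1.
    + exact: thK.
    + by rewrite rpred_div ?rpredD ?rpredX ?rpred_int ?rpred_nat.
    by rewrite rpred_div ?rpredD ?rpredM ?rpredX ?rpred_int ?rpred_nat.
  by have := p_ndvd2X p_pr p_gt2 0; rewrite expr0.
- move=> _ [z [n [[/Fadjoin_polyP[_ /polyOver1P[q ->] zE] [P mP rP]] pn ->]]].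
  set F : {poly rat} := map_poly intr (quartic a b c) in rootL sf f0 f_irr.
  pose k := q %% F; have zk : z = (map_poly (in_alg L) k).[theta].
    rewrite zE [in LHS](divp_eq q F) rmorphD rmorphM /= hornerD hornerM.
    by rewrite (eqP rootL) mulr0 add0r.
  have sk : (size k <= 4)%N by rewrite -ltnS; have := ltn_modpN0 q f0; rewrite sf.
  pose t := s%:~R ^+ 2 + a%:~R : rat.
  (* The coordinates of k, found from the top coefficient downwards. *)
  pose c3 := k`_3 * PM; pose c2 := (k`_2 - k`_3 * s%:~R) * Pm.
  pose c1 := k`_1 - k`_3 * t.
  pose c0 := k`_0 - (k`_2 - k`_3 * s%:~R) * t - k`_3 * (s%:~R * t + b%:~R).
  have hk : h c0 c1 c2 c3 = k.
    apply/polyP => i; rewrite /h basis_polyE coef_Poly /c3 /c2 !mulfK // -/t.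
    case: i => [|[|[|[|i]]]] /=; rewrite /c0 /c1; try by ring.
    by rewrite nth_nil nth_default // (leq_trans sk).
  have sP : (1 < size P)%N.
    have := root_size_gt1 (monic_neq0 (monic_map _ mP)) rP.
    by rewrite size_map_poly_id0 // (monicP mP) rmorph1 oner_eq0.
  have /dvdpP[g gE] : F %| map_poly intr P \Po k.
    apply: (irreducible_dvdp_root f_irr rootL).
    rewrite rootE map_comp_poly horner_comp -zk -map_poly_comp.
    by rewrite (eq_map_poly (rmorph_int (in_alg L))) (eqP rP).
  rewrite mulrC -hk in gE.
  have split N := near_split_exists p_pr p_gt2 N dr reg regN iM im.
  have [z0 z1 z2 z3] := coords_Zloc p_pr p_gt2 mM split mP sP gE.
  have zn : in_Zloc p n%:~R^-1 by apply: Zloc_inv.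
  exists (fun i : 'I_4 => n%:~R^-1 * [:: c0; c1; c2; c3]`_i).
    by case=> -[|[|[|[|//]]]] ? /=; apply: ZlocM.
  under eq_bigr do rewrite -scalerA.
  rewrite -scaler_sumr sumE /= hk -zk mulrC -mulr_algl; congr (_ * _).
  by rewrite -(rmorph_int (in_alg L)) -(fmorphV (in_alg L)).
move=> e _ /eqP; rewrite sumE => he0.
have dv := irreducible_dvdp_root f_irr rootL he0.
have h0 : h (e 0) (e 1) (e 2) (e 3) = 0.
  apply/eqP; apply: contraLR dv => hn0; apply: contraTN isT => /(dvdp_leq hn0).
  by rewrite sf leqNgt /h basis_polyE ltnS size_Poly.
have coefE i : (h (e 0) (e 1) (e 2) (e 3))`_i = 0 by rewrite h0 coef0.
have := coefE 3%N; have := coefE 2%N; have := coefE 1%N; have := coefE 0%N.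
rewrite /h basis_polyE !coef_Poly /= => k0 k1 k2 /eqP.
rewrite mulf_eq0 invr_eq0 (negPf PM0) orbF => /eqP e3.
move: k0 k1 k2; rewrite e3 !mul0r !addr0 => k0 k1 /eqP.
rewrite mulf_eq0 invr_eq0 (negPf Pm0) orbF => /eqP e2.
move: k0; rewrite e2 !mul0r addr0 => e0.
case=> -[|[|[|[|//]]]] lt.
- by rewrite -e0; congr e; apply: val_inj.
- by rewrite -k1; congr e; apply: val_inj.
- by rewrite -e2; congr e; apply: val_inj.
by rewrite -e3; congr e; apply: val_inj.
Qed.

Theorem mainTheorem6 (p : nat) (a b c : int) (f : {poly int})
    (L : fieldExtType rat) (theta : L)
    (p_prime : prime p) (p_gt2 : (2 < p)%N)
    (f_def : f = 'X^4 + a *: 'X^2 + b *: 'X + c%:P)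
    (f_irr : irreducible_poly (map_poly intr f : {poly rat}))
    (theta_root : root (map_poly intr f) theta) :
  (two_double_roots_mod p f <->
     [/\ ~~ (p%:Z %| a)%Z, (p%:Z %| b)%Z, ~~ (p%:Z %| c)%Z,
         (a ^+ 2 = 4 * c %[mod p%:Z])%Z
       & exists t : 'F_p, - a%:~R / 2 = t ^+ 2])
  /\
  (two_double_roots_mod p f ->
   forall (Delta r : \bar rat) (nu_minus nu_plus : int),
     Delta = vp p (monic_disc f) ->
     r = Order.min (vp p b) (vp p (a ^+ 2 - 4 * c)) ->
     nu_minus = Num.floor (fine r / 2) ->
     nu_plus = Num.floor (fine (Delta - r)%E / 2) ->
   forall s : int,
     red_poly p f =
       ('X - (s%:~R)%:P) ^+ 2 * ('X + (s%:~R)%:P) ^+ 2 ->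
     regular_at p f s ->
     regular_at p f (- s) ->
     floor_half_min p f (- s) <= floor_half_min p f s ->
     p_integral_basis p <<1; theta>>%AS
       [tuple 1;
              theta;
              (theta ^+ 2 + (s ^+ 2 + a)%:~R) / p%:R ^ nu_minus;
              (theta ^+ 3 + s%:~R * theta ^+ 2 + (a + s ^+ 2)%:~R * theta
                 + (s ^+ 3 + a * s + b)%:~R) / p%:R ^ nu_plus]).
Proof.
subst f. rewrite -/(quartic a b c) in f_irr theta_root *.
have equiv := two_double_roots_quartic a b c p_prime p_gt2.
split=> // /equiv[_ _ pc _ _] Delta r nu_minus nu_plus -> -> -> -> s red reg regN fl.
have dr := double_roots_red p_prime p_gt2 pc red.
have [M [ME M0 M1 Mmax]] := floor_half_minP p_prime (horner_s_neq0 s f_irr).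
have [m [mE m0 m1 mmax]] := floor_half_minP p_prime (horner_s_neq0 (- s) f_irr).
rewrite ME mE lez_nat in fl.
have iM : index_at p a b c s M by [].
have im : index_at p a b c (- s) m by [].
have [-> ->] := nu_values p_prime p_gt2 dr reg regN iM im fl.
exact: (p_integral_basis_split p_prime p_gt2 fl f_irr theta_root dr reg regN iM im).
Qed.
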